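(* Let $p\ge 3$ be a prime, and let $N$ be a positive integer such that $pN\equiv 5 \pmod 8$. Let $\alpha$ be any nonnegative integer. (1) If $p\equiv 1\pmod 3$, then \[\mathrm{pod}\Big(\frac{3p^{6\alpha+5}N+1}{8}\Big)\equiv 0\pmod 3\] and \[\mathrm{pod}\Big(\frac{3p^{18\alpha+17}N+1}{8}\Big)\equiv 0\pmod 9.\] (2) If $p\equiv 2\pmod 3$, then \[\mathrm{pod}\Big(\frac{3p^{4\alpha+3}N+1}{8}\Big)\equiv 0\pmod 9.\]
   Context: For an integer $n\ge 0$, $\mathrm{pod}(n)$ denotes the number of partitions of $n$ in which the odd parts are distinct (even parts may repeat); equivalently $\sum_{n\ge 0}\mathrm{pod}(n)q^n=\prod_{i\ge 1}\frac{1+q^{2i-1}}{1-q^{2i}}$.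
   Formalization: The formal theorem adds the hypothesis that p does not divide N; without it the claim is false, e.g. p=5, N=25, α=0, where pod(1172) is not divisible by 9. *)

(* Defs.v *)
From mathcomp Require Import all_boot.

Set Implicit Arguments.
Unset Strict Implicit.
Unset Printing Implicit Defensive.

(* A partition of n is encoded by its multiplicities: [m i] is the number of
   times the part [i.+1] occurs.  Parts and multiplicities are at most n, so
   nothing is lost by the finite domain and codomain. *)
Definition is_partition n (m : {ffun 'I_n -> 'I_n.+1}) : bool :=
  \sum_(i < n) m i * i.+1 == n.

Definition odd_parts_distinct n (m : {ffun 'I_n -> 'I_n.+1}) : bool :=
  [forall i : 'I_n, odd i.+1 ==> (m i <= 1)].

Definition pod (n : nat) : nat :=
  #|[set m : {ffun 'I_n -> 'I_n.+1} | is_partition m && odd_parts_distinct m]|.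

(* Main.v *)
(* Let psi = sum_j q^(j(j+1)/2).  Gauss's identity gives
   sum_n (-1)^n pod(n) q^n = 1 / psi(q).  Writing psi(q) = A(q^3) + q psi(q^9), the
   product formula for psi yields A(q^3)^3 + q^3 psi(q^9)^3 = psi(q^3)^4 / psi(q^9),
   and since psi(q)^9 = psi(q^3)^3 modulo 9 we get
   pod(3m+2) = +- [q^m] psi(q)^5 modulo 9.

   Put S(D) = sum of c over the integral forms (a, b, c) of discriminant D with
   a < 0 < c.  Zagier's argument shows that the sum of Q(x) over the forms Q of
   nonsquare discriminant D with a < 0 < Q(x) does not depend on the rational x, and
   is S(D); its analogue for Q(x)^3 gives a recurrence proving
   psi^4 = sum_n sigma(2n+1) q^n, hence 2 [q^m] psi^5 = S(8m+5).  Evaluating the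
   constant at 0, j/p (0 <= j < p) and counting the forms of discriminant D p^2 that
   come from discriminant D gives, for p | D,
     S(D p^2) + p^3 S(D / p^2) = (1 + p^3) S(D),
   whence S(p^(2k+1) N) = (1 + p^3 + ... + p^(3k)) S(p N). *)
Require Import Defs.
From mathcomp Require Import all_boot.
From mathcomp Require Import all_order all_algebra algC cyclotomic zify ring.
From mathcomp Require Import boolp classical_sets functions cardinality fsbigop.

Set Implicit Arguments.
Unset Strict Implicit.
Unset Printing Implicit Defensive.

Import Order.TTheory GRing.Theory Num.Theory.

(** * Sums over indefinite binary quadratic forms *)

Section QuadraticForms.
Local Open Scope ring_scope.
Local Open Scope classical_set_scope.

Definition form : Type := (int * int * int)%type.

Definition disc (Q : form) : int :=
  let: (a, b, c) := Q in b ^+ 2 - 4 * a * c.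

Definition form_eval (Q : form) (r s : int) : int :=
  let: (a, b, c) := Q in a * r ^+ 2 + b * r * s + c * s ^+ 2.

Lemma reindex_cancel (I J : choiceType) (h : I -> J) (h' : J -> I)
    (P : set I) (Q : set J) (F : J -> int) :
    cancel h h' -> cancel h' h ->
    (forall x, P x -> Q (h x)) -> (forall y, Q y -> P (h' y)) ->
  \sum_(y \in Q) F y = \sum_(x \in P) F (h x).
Proof.
move=> hK h'K PQ QP; apply: reindex_fsbig; split.
- by move=> x /PQ.
- by move=> x y _ _; apply: can_inj hK _ _.
- by move=> y /QP Py; exists (h' y).
Qed.

Lemma bounded_forms_finite (P : set form) (B : nat) :
    (forall a b c, P (a, b, c) -> [/\ `|a| <= B%:Z, `|b| <= B%:Z & `|c| <= B%:Z]) ->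
  finite_set P.
Proof.
move=> PB; pose I := [seq (i%:Z - B%:Z : int) | i <- iota 0 (2 * B).+1].
have inI (x : int) : `|x| <= B%:Z -> x \in I.
  move=> xB; apply/mapP; exists (absz (x + B%:Z)); last by lia.
  by rewrite mem_iota; lia.
apply: (@sub_finite_set _ _ [set` [seq (u, c) | u <- [seq (a, b) | a <- I, b <- I],
  c <- I]]); last exact: finite_seq.
case=> [[a b] c] /PB[aB bB cB].
rewrite /mkset.
apply/allpairsP; exists ((a, b), c); split=> //; last exact: inI.
by apply/allpairsP; exists (a, b); split=> //; apply: inI.
Qed.

(* Zagier's sums: forms with a < 0 that are positive at the point r/s, written
   homogeneously in (r, s) to avoid rational arguments. *)
Definition cycle_forms (D r s : int) : set form :=
  [set Q | [/\ disc Q = D, Q.1.1 < 0 & 0 < form_eval Q r s]].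

(** Completing the square, (2ar + bs)^2 + 4(-a)Q(r, s) = D s^2 with both terms on the left
    nonnegative. This bounds a and 2ar + bs, hence b as s is nonzero, and then c through 4ac = b^2 -
    D with a nonzero. *)
Lemma cycle_forms_finite (D r s : int) : s != 0 -> finite_set (cycle_forms D r s).
Proof.
move=> s0.
pose M := `|D| * s ^+ 2; pose N := M * (1 + 2 * `|r|).
have norm_le_sqr (x : int) : `|x| <= x ^+ 2 by nia.
have s2 : 0 < s ^+ 2 by rewrite exprn_even_gt0.
have M0 : 0 <= M by rewrite mulr_ge0// ltW.
have N0 : 0 <= N by rewrite mulr_ge0//; lia.
apply: (@bounded_forms_finite _ (absz (M + N + N ^+ 2 + `|D|))) => a b c [].
rewrite /disc /form_eval => dQ a0 Q0; rewrite /= in a0.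
have key : (2 * a * r + b * s) ^+ 2
    + 4 * (- a * (a * r ^+ 2 + b * r * s + c * s ^+ 2)) = D * s ^+ 2.
  by rewrite -dQ; ring.
move: Q0 key; set q := _ + c * s ^+ 2; set u := 2 * a * r + b * s => q0 key.
have DM : D * s ^+ 2 <= M by rewrite ler_wpM2r ?ler_norm// ltW.
have u2 : 0 <= u ^+ 2 := sqr_ge0 u.
have aq : - a <= - a * q by rewrite ler_peMr; lia.
have aM : - a <= M by lia.
have uM : `|u| <= M by have := norm_le_sqr u; lia.
have bN : `|b| <= N.
  have -> : N = M + 2 * (M * `|r|) by rewrite /N; ring.
  have : `|b| <= `|b * s| by rewrite normrM ler_peMr//; lia.
  have : `|a * r| <= M * `|r| by rewrite normrM ler_wpM2r//; lia.
  have -> : b * s = u - 2 * (a * r) by rewrite /u; ring.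
  by clear - uM; lia.
have b2 : b ^+ 2 <= N ^+ 2.
  by rewrite -[b ^+ 2]real_normK ?num_real// lerXn2r ?nnegrE.
have cB : `|c| <= N ^+ 2 + `|D|.
  have : `|c| <= `|a * c| by rewrite normrM ler_peMl//; lia.
  have : D = b ^+ 2 - 4 * (a * c) by rewrite -dQ; ring.
  move: b2 (sqr_ge0 b); move: (b ^+ 2) (N ^+ 2) (a * c); clear; lia.
clear - M0 N0 aM bN cB a0; have := sqr_ge0 N; move: M0 N0 aM bN cB a0.
move: (N ^+ 2) => N2; move: M N; clear.
by move=> M N; split; lia.
Qed.

Definition indef_forms (D : int) : set form :=
  [set Q | [/\ disc Q = D, Q.1.1 < 0 & 0 < Q.2]].

Lemma indef_formsE (D : int) : indef_forms D = cycle_forms D 0 1.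
Proof.
apply/seteqP; split=> -[[a b] c] /= [dQ a0 c0]; split=> //=.
- by move: c0; rewrite /=; lia.
- by move: c0; rewrite /=; lia.
Qed.

Lemma indef_forms_finite (D : int) : finite_set (indef_forms D).
Proof. by rewrite indef_formsE; apply: cycle_forms_finite. Qed.

Section CycleSum.
Variables (phi : int -> int) (D : int).
Hypothesis phiN : forall x, phi (- x) = - phi x.
Hypothesis D_nsq : forall b : int, b ^+ 2 != D.

Definition cycle_sum (r s : int) : int :=
  \sum_(Q \in cycle_forms D r s) phi (form_eval Q r s).

(** The unipotent substitution keeps the leading coefficient, hence the condition a < 0, and the
    discriminant. *)
Lemma cycle_sum_shift (r s : int) : cycle_sum (r + s) s = cycle_sum r s.
Proof.
rewrite /cycle_sum.
pose h (Q : form) : form := let: (a, b, c) := Q in (a, b - 2 * a, a - b + c).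
pose h' (Q : form) : form := let: (a, b, c) := Q in (a, b + 2 * a, a + b + c).
have ev Q : form_eval (h Q) (r + s) s = form_eval Q r s.
  by case: Q => [[a b] c] /=; ring.
have ev' Q : form_eval (h' Q) r s = form_eval Q (r + s) s.
  by case: Q => [[a b] c] /=; ring.
rewrite (reindex_cancel (h := h) (h' := h') (P := cycle_forms D r s)).
- by apply: eq_fsbigr => Q _; rewrite ev.
- by case=> [[a b] c] /=; congr (_, _, _); ring.
- by case=> [[a b] c] /=; congr (_, _, _); ring.
- move=> Q [dQ a0 Q0]; split; rewrite ?ev//; last by case: Q a0 {dQ Q0} => [[]].
  by rewrite -dQ; case: Q {dQ a0 Q0} => [[a b] c] /=; ring.
- move=> Q [dQ a0 Q0]; split; rewrite ?ev'//; last by case: Q a0 {dQ Q0} => [[]].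
  by rewrite -dQ; case: Q {dQ a0 Q0} => [[a b] c] /=; ring.
Qed.

Lemma cycle_sumN (r s : int) : cycle_sum (- r) s = cycle_sum r s.
Proof.
rewrite /cycle_sum.
pose h (Q : form) : form := let: (a, b, c) := Q in (a, - b, c).
have ev Q : form_eval (h Q) (- r) s = form_eval Q r s.
  by case: Q => [[a b] c] /=; ring.
have ev' Q : form_eval (h Q) r s = form_eval Q (- r) s.
  by case: Q => [[a b] c] /=; ring.
have hK : cancel h h by case=> [[a b] c] /=; rewrite opprK.
rewrite (reindex_cancel (h := h) (h' := h) (P := cycle_forms D r s)) //.
- by apply: eq_fsbigr => Q _; rewrite ev.
- move=> Q [dQ a0 Q0]; split; rewrite ?ev//; last by case: Q a0 {dQ Q0} => [[]].
  by rewrite -dQ; case: Q {dQ a0 Q0} => [[a b] c] /=; ring.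
- move=> Q [dQ a0 Q0]; split; rewrite ?ev'//; last by case: Q a0 {dQ Q0} => [[]].
  by rewrite -dQ; case: Q {dQ a0 Q0} => [[a b] c] /=; ring.
Qed.

(** Exchanging a and c turns the second sum into one over forms with c < 0. Forms with a, c < 0
    cancel. Left over are the forms a < 0 < c positive at (r, s) and, subtracted, those with c < 0 <
    a; negating the latter gives the forms a < 0 < c negative at (r, s), with the right sign since
    [phi] is odd. As D is not a square, a and c never vanish. *)
Lemma cycle_sum_swap (r s : int) : r != 0 -> s != 0 ->
  cycle_sum r s - cycle_sum s r =
  \sum_(Q \in indef_forms D) phi (form_eval Q r s).
Proof.
move=> r0 s0.
have phi0 : phi 0 = 0 by have := phiN 0; rewrite oppr0; move: (phi 0) => x; lia.
have c_neq0 (Q : form) : disc Q = D -> Q.2 != 0.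
  case: Q => [[a b] c] /= dQ; apply/eqP => c0; case/eqP: (D_nsq b).
  by rewrite -dQ c0; ring.
have a_neq0 (Q : form) : disc Q = D -> Q.1.1 != 0.
  case: Q => [[a b] c] /= dQ; apply/eqP => a0; case/eqP: (D_nsq b).
  by rewrite -dQ a0; ring.
pose F Q := phi (form_eval Q r s).
pose swap (Q : form) : form := let: (a, b, c) := Q in (c, b, a).
have ev_swap Q : form_eval (swap Q) s r = form_eval Q r s.
  by case: Q => [[a b] c] /=; ring.
have ev_swap' Q : form_eval (swap Q) r s = form_eval Q s r.
  by case: Q => [[a b] c] /=; ring.
have disc_swap Q : disc (swap Q) = disc Q by case: Q => [[a b] c] /=; ring.
have swapK : cancel swap swap by case=> [[a b] c].
pose V := [set Q | [/\ disc Q = D, Q.2 < 0 & 0 < form_eval Q r s]].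
have swap_sum : cycle_sum s r = \sum_(Q \in V) F Q.
  rewrite /cycle_sum (reindex_cancel (h := swap) (h' := swap) (P := V)) //.
  - by apply: eq_fsbigr => Q _; rewrite ev_swap.
  - move=> Q [dQ c0 Q0]; split; rewrite ?ev_swap ?disc_swap//.
    by case: Q c0 {dQ Q0} => [[]].
  - move=> Q [dQ a0 Q0]; split; rewrite ?ev_swap' ?disc_swap//.
    by case: Q a0 {dQ Q0} => [[]].
have V_finite : finite_set V.
  have -> : V = swap @` cycle_forms D s r.
    apply/seteqP; split=> [Q [dQ c0 Q0]|_ [Q [dQ a0 Q0] <-]].
      exists (swap Q); last by rewrite swapK.
      split; rewrite ?ev_swap ?disc_swap//.
      by case: Q c0 {dQ Q0} => [[]].
    split; rewrite ?ev_swap' ?disc_swap//.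
    by case: Q a0 {dQ Q0} => [[]].
  exact/finite_image/cycle_forms_finite.
pose opp (Q : form) : form := let: (a, b, c) := Q in (- a, - b, - c).
have ev_opp Q : form_eval (opp Q) r s = - form_eval Q r s.
  by case: Q => [[a b] c] /=; ring.
have oppK : cancel opp opp by case=> [[a b] c] /=; rewrite !opprK.
pose pos := [set Q : form | 0 < form_eval Q r s].
rewrite swap_sum /cycle_sum -/F.
rewrite (fsbigID [set Q : form | 0 < Q.2] (cycle_forms D r s)) /=; last first.
  exact: cycle_forms_finite.
rewrite (fsbigID [set Q : form | Q.1.1 < 0] V) //=.
rewrite (fsbigID pos (indef_forms D)) /=; last exact: indef_forms_finite.
have -> : \sum_(Q \in cycle_forms D r s `&` [set Q : form | 0 < Q.2]) F Q
        = \sum_(Q \in indef_forms D `&` pos) F Q.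
  apply: eq_fsbigl; apply/seteqP.
  by split=> Q [] []; rewrite /pos /=; split; rewrite //=; split.
have -> : \sum_(Q \in cycle_forms D r s `&` ~` [set Q : form | 0 < Q.2]) F Q
        = \sum_(Q \in V `&` [set Q : form | Q.1.1 < 0]) F Q.
  apply: eq_fsbigl; apply/seteqP; split=> Q [[dQ Q1 Q2] Q3].
    by have := c_neq0 Q dQ; move: Q3 => /= Q3 cQ; do 2?split=> //; lia.
  by split=> //; move=> /=; lia.
have -> : \sum_(Q \in indef_forms D `&` ~` pos) F Q =
    - \sum_(Q \in V `&` ~` [set Q : form | Q.1.1 < 0]) F Q.
  rewrite [X in - X](reindex_cancel (h := opp) (h' := opp)
    (P := indef_forms D `&` [set Q : form | form_eval Q r s < 0])) //; last 2 first.
  - move=> Q [[dQ a0 c0] /= Q0]; do 2?split; rewrite ?ev_opp; try lia.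
    + by rewrite -dQ; case: Q {dQ a0 c0 Q0} => [[a b] c] /=; ring.
    + by case: Q {dQ a0 Q0} c0 => [[a b] c] /=; lia.
    + by case: Q {dQ c0 Q0} a0 => [[a b] c] /=; lia.
  - move=> Q [[dQ c0 Q0] /= a0]; have an0 := a_neq0 Q dQ.
    split; last by rewrite /= ev_opp; lia.
    split.
    + by rewrite -dQ; case: Q {dQ a0 c0 Q0 an0} => [[a b] c] /=; ring.
    + by case: Q {dQ c0 Q0} a0 an0 => [[a b] c] /=; lia.
    + by case: Q {dQ a0 Q0 an0} c0 => [[a b] c] /=; lia.
  rewrite -mulN1r mulr_fsumr.
  (* The complement of [pos] also contains the forms vanishing at (r, s); they contribute
     [phi 0 = 0]. *)
  rewrite -(@fsbig_widen _ _ _ _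
    (indef_forms D `&` [set Q : form | form_eval Q r s < 0])).
  - by apply: eq_fsbigr => Q _; rewrite /F ev_opp phiN; ring.
  - by move=> Q [WQ /= Q0]; split=> //; rewrite /pos /=; lia.
  - move=> Q [[WQ /= Q0] nQ]; rewrite /pos /= in Q0.
    have Q00 : form_eval Q r s = 0.
      by apply: contra_notP nQ => /= ?; split=> //=; lia.
    by rewrite /F /= Q00 phi0.
by ring.
Qed.

End CycleSum.

End QuadraticForms.

(** * Linear and cubic moments of the forms with a < 0 < c *)

Section IndefiniteSums.
Local Open Scope ring_scope.
Local Open Scope classical_set_scope.

(** The involutions b -> -b and (a, b, c) -> (-c, b, -a) commute and preserve the set of forms, so
    adding the four transforms of the sum gives four times the sum. *)
Lemma indef_sum_eq0 (D : int) (F : form -> int) :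
    (forall a b c, F (a, b, c) + F (a, - b, c) + F (- c, b, - a) + F (- c, - b, - a) = 0) ->
  \sum_(Q \in indef_forms D) F Q = 0.
Proof.
move=> F0.
pose bneg (Q : form) : form := let: (a, b, c) := Q in (a, - b, c).
pose flip (Q : form) : form := let: (a, b, c) := Q in (- c, b, - a).
have bnegK : cancel bneg bneg by case=> [[a b] c] /=; rewrite opprK.
have flipK : cancel flip flip by case=> [[a b] c] /=; rewrite !opprK.
have bneg_sum (G : form -> int) :
    \sum_(Q \in indef_forms D) G Q = \sum_(Q \in indef_forms D) G (bneg Q).
  rewrite (reindex_cancel (h := bneg) (h' := bneg) (P := indef_forms D)) //.
  - by move=> [[a b] c] [/= <- a0 c0]; split=> //=; ring.
  - by move=> [[a b] c] [/= <- a0 c0]; split=> //=; ring.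
have flip_sum (G : form -> int) :
    \sum_(Q \in indef_forms D) G Q = \sum_(Q \in indef_forms D) G (flip Q).
  rewrite (reindex_cancel (h := flip) (h' := flip) (P := indef_forms D)) //.
  - by move=> [[a b] c] [/= <- a0 c0]; split=> /=; first ring; lia.
  - by move=> [[a b] c] [/= <- a0 c0]; split=> /=; first ring; lia.
set X := \sum_(Q \in _) _.
have: X + \sum_(Q \in indef_forms D) F (bneg Q)
    + \sum_(Q \in indef_forms D) F (flip Q)
    + \sum_(Q \in indef_forms D) F (flip (bneg Q)) = 0.
  have Wfin := indef_forms_finite D.
  rewrite -!fsbig_split//= fsbig1// => -[[a b] c] _ /=.
  exact: F0.
rewrite -bneg_sum -flip_sum -(bneg_sum (fun Q => F (flip Q))) -flip_sum -/X.
lia.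
Qed.

(** This is S(D) of the overview. For a fundamental discriminant D > 1, Siegel's formula makes it 60
    zeta_K(-1) with K = Q(sqrt D). *)
Definition class_sum (D : int) : int := \sum_(Q \in indef_forms D) Q.2.

(** Averaging over the symmetries kills the term b r s and lets -c replace a. *)
Lemma sum_indef_eval (D r s : int) :
  \sum_(Q \in indef_forms D) form_eval Q r s = class_sum D * (s ^+ 2 - r ^+ 2).
Proof.
apply/eqP; rewrite -subr_eq0 mulrC /class_sum mulr_fsumr -mulN1r mulr_fsumr.
rewrite -fsbig_split/=; last exact: indef_forms_finite.
by rewrite indef_sum_eq0// => a b c /=; ring.
Qed.

(* Translation and inversion run the Euclidean algorithm on (r, s); with
   [phi = id] the inversion defect is [class_sum D * (s^2 - r^2)], so
   [cycle_sum - class_sum D * s^2] is invariant and vanishes at (0, s). *)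
Lemma cycle_sum_id (D : int) (D_nsq : forall b : int, b ^+ 2 != D) (r s : nat) :
  (0 < s)%N -> cycle_sum id D r%:Z s%:Z = class_sum D * s%:Z ^+ 2.
Proof.
have [n] := ubnP (r + s)%N; elim: n r s => // n IHn r s rs s0.
have [->|r0] := posnP r.
  rewrite /cycle_sum /class_sum indef_formsE mulrC mulr_fsumr.
  have -> : cycle_forms D 0 s%:Z = cycle_forms D 0 1.
    apply/seteqP; split=> -[[a b] c] [dQ a0 Q0]; split=> //.
    - by move: Q0; rewrite /=; nia.
    - by move: Q0; rewrite /=; nia.
  by apply: eq_fsbigr => -[[a b] c] _ /=; ring.
have [sr|rs'] := leqP s r.
  rewrite -(subnK sr) PoszD cycle_sum_shift IHn//; lia.
have := @cycle_sum_swap id D (fun=> erefl) D_nsq r%:Z s%:Z _ _.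
rewrite sum_indef_eval => /(_ _ _)/eqP; rewrite subr_eq => /(_ _ _)/eqP-> //; try lia.
rewrite -{2}(subnK (ltnW rs')) PoszD cycle_sum_shift IHn//; lia.
Qed.

(* The defects [P r s] of [phi = cube] must be compatible along the path
   (3,2) -> (1,2) -> (2,1) and (2,3) -> (1,3) -> (3,1); the resulting relation
   [P 3 2 = P 3 1 - P 2 1] kills the coefficient of [r^2 s^4 - r^4 s^2].  This is
   the absence of cusp forms of weight 8. *)
Lemma sum_indef_cubic (D : int) (D_nsq : forall b : int, b ^+ 2 != D) :
  \sum_(Q \in indef_forms D) (Q.1.1 * Q.2 ^+ 2 + Q.1.2 ^+ 2 * Q.2) = 0.
Proof.
pose cube (x : int) := x ^+ 3.
pose P r s := \sum_(Q \in indef_forms D) cube (form_eval Q r s).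
have cubeN x : cube (- x) = - cube x by rewrite /cube; ring.
pose g := cycle_sum cube D.
have swap r s : r != 0 -> s != 0 -> g r s - g s r = P r s.
  by move=> r0 s0; exact: (cycle_sum_swap cubeN D_nsq r0 s0).
have shift r s : g (r + s) s = g r s by apply: cycle_sum_shift.
have g11 : g 1 1 = g 0 1 by rewrite -[in LHS](add0r 1) shift.
have g21 : g 2 1 = g 0 1 by rewrite -g11 -[RHS]shift.
have g31 : g 3 1 = g 0 1 by rewrite -g21 -[RHS]shift.
have g32 : g 3 2 = g 1 2 by rewrite -[RHS]shift.
have g23 : g 2 3 = g 1 3.
  by rewrite -[LHS]cycle_sumN -[LHS](shift (- 2) 3).
have s21 := swap 2 1 isT isT; have s31 := swap 3 1 isT isT.
have s32 := swap 3 2 isT isT.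
have P_rel : P 3 1 - P 2 1 - P 3 2 = 0.
  by rewrite -s21 -s31 -s32 g32 g23 g21 g31; ring.
set X := \sum_(Q \in _) _.
(* By the symmetries, P r s = u (s^6 - r^6) + 3 X (r^2 s^4 - r^4 s^2) for some u independent of r
   and s. In this combination u has coefficient -728 + 63 + 665 = 0 and X has 3 (-72 + 12 + 180) =
   360. *)
suff : P 3 1 - P 2 1 - P 3 2 - 360 * X = 0 by rewrite P_rel; lia.
have -> : P 3 1 - P 2 1 - P 3 2 - 360 * X
        = P 3 1 + (-1) * P 2 1 + (-1) * P 3 2 + (- 360) * X by ring.
have Wfin := indef_forms_finite D.
rewrite /P /X !mulr_fsumr -!fsbig_split//=.
by rewrite indef_sum_eq0// => a b c; rewrite /cube /=; ring.
Qed.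

End IndefiniteSums.

(** * Hecke relation for class sums *)

Section HeckeCount.
Local Open Scope ring_scope.
Variable p : nat.
Hypotheses (p_prime : prime p) (p_odd : odd p).

Lemma Euclid_dvdzM (x y : int) : (p %| x * y)%Z = (p %| x)%Z || (p %| y)%Z.
Proof. by rewrite !dvdzE abszM Euclid_dvdM. Qed.

Lemma linear_root_mod (u v : int) : ~~ (p %| u)%Z ->
  exists j0 : 'I_p, forall j : 'I_p, (p %| v - u * (j : nat)%:Z)%Z = (j == j0).
Proof.
move=> pu; have p0 := prime_gt0 p_prime.
have pN0 : p%:Z != 0 by lia.
have cop : coprimez u p.
  by rewrite coprimez_sym coprimezE prime_coprime// -dvdzE.
have [[x y] /= xy] := coprimezP _ _ cop.
have lt_p : (absz ((v * x) %% p)%Z < p)%N.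
  by have := modz_ge0 (v * x) pN0; have := ltz_pmod (v * x) (_ : 0 < p%:Z); lia.
exists (Ordinal lt_p) => j.
have -> : (p %| v - u * (j : nat)%:Z)%Z = (p %| v * x - (j : nat)%:Z)%Z.
  apply/idP/idP => [pd|/dvdzP[z zE]].
  - have -> : v * x - (j : nat)%:Z =
      x * (v - u * (j : nat)%:Z) - y * (j : nat)%:Z * p
      + (x * u + y * p - 1) * (j : nat)%:Z by ring.
    by rewrite xy subrr mul0r addr0 rpredB ?dvdz_mull// dvdz_mull.
  - apply/dvdzP; exists (z * u + v * y).
    have -> : v = v * (x * u + y * p) by rewrite xy mulr1.
    have -> : v * (x * u + y * p) - u * (j : nat)%:Z
      = u * (v * x - (j : nat)%:Z) + v * y * p by ring.
    by rewrite zE xy mulr1; ring.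
rewrite -eqz_mod_dvd (modz_small (m := (j : nat)%:Z)); last first.
  by rewrite ltz_nat ltn_ord.
rewrite -(inj_eq val_inj) /= eq_sym -eqz_nat gez0_abs//.
exact: modz_ge0.
Qed.

Lemma sum_pred1_ord (P : pred 'I_p) (j0 : 'I_p) :
  (forall j, P j = (j == j0)) -> (\sum_(j < p) P j = 1)%N.
Proof.
move=> PE; rewrite (eq_bigr (fun j => (j == j0) : nat)) => [|j _]; last by rewrite PE.
by rewrite (bigD1 j0)//= eqxx big1 ?addn0// => j /negPf->.
Qed.

Lemma dvdz_sqr2 (x : int) : (p%:Z ^+ 2 %| x ^+ 2)%Z = (p %| x)%Z.
Proof. by rewrite !dvdzE !abszX dvdn_pexp2r. Qed.

Lemma p_ndvd2 : (p %| 2)%Z = false.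
Proof.
apply/negbTE; rewrite dvdzE /=; apply/negP => /dvdn_leq => /(_ isT) p2.
have p2' : p = 2%N by have := prime_gt1 p_prime; lia.
by move: p_odd; rewrite p2'.
Qed.

(* Number of the p + 1 index-p superlattices to which the form (a, b, c), of
   discriminant divisible by p^3, extends integrally. *)
Lemma hecke_count (a b c : int) : (p%:Z ^+ 3 %| b ^+ 2 - 4 * a * c)%Z ->
  (((p%:Z ^+ 2)%R %| a)%Z && (p %| b)%Z + \sum_(j < p)
     ((p %| (b - 2 * a * (j : nat)%:Z)%R)%Z
      && ((p%:Z ^+ 2)%R %| (c - b * (j : nat)%:Z + a * (j : nat)%:Z ^+ 2)%R)%Z)
   = 1 + p * [&& ((p%:Z ^+ 2)%R %| a)%Z, ((p%:Z ^+ 2)%R %| b)%Z & ((p%:Z ^+ 2)%R %| c)%Z])%N.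
Proof.
move=> dD; have p_neq0 : p%:Z != 0 by have := prime_gt0 p_prime; lia.
have p2_neq0 : p%:Z ^+ 2 != 0 by rewrite expf_neq0.
have dvd_p2 (x : int) : (p%:Z ^+ 2 %| x)%Z -> (p %| x)%Z.
  by move=> h; apply: dvdz_trans h; rewrite expr2 dvdz_mulr.
have p24 : coprimez (p%:Z ^+ 2) 4.
  rewrite coprimezXl// (_ : 4 = 2 ^+ 2)// coprimezXr// coprimezE /=.
  by rewrite prime_coprime//; have := p_ndvd2; rewrite dvdzE /= => ->.
have d2 : (p%:Z ^+ 2 %| b ^+ 2 - 4 * a * c)%Z.
  by apply: dvdz_trans dD; rewrite exprSr dvdz_mulr.
have ndvd2M (x : int) : (p %| 2 * x)%Z = (p %| x)%Z by rewrite Euclid_dvdzM p_ndvd2.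
(* If p does not divide a, only the root j of b = 2aj mod p can count. It does, since 4a(c - bj +
   aj^2) = (b - 2aj)^2 - (b^2 - 4ac) is divisible by p^2. *)
have [pa|npa] := boolP (p %| a)%Z; last first.
  have npa2 : (p%:Z ^+ 2 %| a)%Z = false.
    by apply/negbTE/negP => /dvd_p2; rewrite (negPf npa).
  have [|j0 j0P] := @linear_root_mod (2 * a) b; first by rewrite ndvd2M.
  rewrite npa2 (sum_pred1_ord (j0 := j0)) ?muln0// => j.
  rewrite j0P andb_idr// => jj0.
  have : (p%:Z ^+ 2 %| 4 * (a * (c - b * (j : nat)%:Z + a * (j : nat)%:Z ^+ 2)))%Z.
    have -> : 4 * (a * (c - b * (j : nat)%:Z + a * (j : nat)%:Z ^+ 2))
      = (b - 2 * a * (j : nat)%:Z) ^+ 2 - (b ^+ 2 - 4 * a * c) by ring.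
    by rewrite rpredB// dvdz_sqr2 j0P.
  rewrite Gauss_dvdzr// Gauss_dvdzr//.
  by rewrite coprimezXl// coprimezE prime_coprime// -dvdzE.
have pb : (p %| b)%Z.
  have : (p %| b ^+ 2)%Z.
    have -> : b ^+ 2 = b ^+ 2 - 4 * a * c + 4 * c * a by ring.
    by rewrite rpredD ?dvdz_mull// dvd_p2.
  by rewrite expr2 Euclid_dvdzM orbb.
have pj (j : 'I_p) : (p %| b - 2 * a * (j : nat)%:Z)%Z.
  by rewrite rpredB// dvdz_mulr// dvdz_mull.
under eq_bigr do rewrite pj andTb.
rewrite pb andbT.
have p_j (j : 'I_p) : (p %| - b * (j : nat)%:Z + a * (j : nat)%:Z ^+ 2)%Z.
  by rewrite rpredD ?dvdz_mulr// rpredN.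
(* If p divides a and b but not c, no j counts because c - bj + aj^2 = c mod p; the first term does,
   since 4ac = b^2 - (b^2 - 4ac) forces p^2 to divide a. *)
have [pc|npc] := boolP (p %| c)%Z; last first.
  have npc2 : (p%:Z ^+ 2 %| c)%Z = false.
    by apply/negbTE/negP => /dvd_p2; rewrite (negPf npc).
  have pa2 : (p%:Z ^+ 2 %| a)%Z.
    have : (p%:Z ^+ 2 %| 4 * (c * a))%Z.
      have -> : 4 * (c * a) = b ^+ 2 - (b ^+ 2 - 4 * a * c) by ring.
      by rewrite rpredB// dvdz_sqr2.
    rewrite !Gauss_dvdzr//.
    by rewrite coprimezXl// coprimezE prime_coprime// -dvdzE.
  rewrite npc2 !andbF muln0 pa2 big1// => j _.
  rewrite [X in nat_of_bool X](_ : _ = false)//; apply/negbTE/negP => /dvd_p2.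
  by rewrite -addrA -mulNr rpredDr ?(negPf npc).
(* If p divides all coefficients, divide by p. The remaining discriminant is still divisible by p,
   which uses the cube in the hypothesis. So c1 - b1 j + a1 j^2 has a single double root mod p when
   p does not divide a1, and is constant in j mod p otherwise. *)
move: pa pb pc dD {d2 pj p_j} => /dvdzP[a1 ->] /dvdzP[b1 ->] /dvdzP[c1 ->].
have dvd2M (x : int) : (p%:Z ^+ 2 %| x * p)%Z = (p %| x)%Z by rewrite expr2 dvdz_mul2r.
rewrite !dvd2M.
have -> : (b1 * p) ^+ 2 - 4 * (a1 * p) * (c1 * p) = (b1 ^+ 2 - 4 * a1 * c1) * p%:Z ^+ 2.
  by ring.
rewrite exprS dvdz_mul2r// => d1.
have quad (j : 'I_p) : (p%:Z ^+ 2 %| c1 * p - b1 * p * (j : nat)%:Z + a1 * p * (j : nat)%:Z ^+ 2)%Z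
    = (p %| c1 - b1 * (j : nat)%:Z + a1 * (j : nat)%:Z ^+ 2)%Z.
  by rewrite -dvd2M; congr (_ %| _)%Z; ring.
under eq_bigr do rewrite quad.
have [pa|npa] /= := boolP (p %| a1)%Z; last first.
  have [|j0 j0P] := @linear_root_mod (2 * a1) b1; first by rewrite ndvd2M.
  rewrite (sum_pred1_ord (j0 := j0)) ?muln0// => j.
  rewrite -j0P.
  have -> : (p %| b1 - 2 * a1 * (j : nat)%:Z)%Z
    = (p %| (b1 - 2 * a1 * (j : nat)%:Z) ^+ 2)%Z by rewrite expr2 Euclid_dvdzM orbb.
  have -> : (b1 - 2 * a1 * (j : nat)%:Z) ^+ 2 = (b1 ^+ 2 - 4 * a1 * c1)
    + 2 * (2 * (a1 * (c1 - b1 * (j : nat)%:Z + a1 * (j : nat)%:Z ^+ 2))) by ring.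
  by rewrite [RHS]rpredDl// !ndvd2M Euclid_dvdzM (negPf npa).
have pb : (p %| b1)%Z.
  have : (p %| b1 ^+ 2)%Z.
    have -> : b1 ^+ 2 = b1 ^+ 2 - 4 * a1 * c1 + 4 * c1 * a1 by ring.
    by rewrite rpredD ?dvdz_mull.
  by rewrite expr2 Euclid_dvdzM orbb.
rewrite pb /= (eq_bigr (fun=> (p %| c1)%Z : nat)) => [|j _].
  by rewrite sum_nat_const card_ord.
by rewrite -addrA rpredDr// rpredD ?dvdz_mulr// -mulNr dvdz_mulr// rpredN.
Qed.

End HeckeCount.

Section HeckeRelation.
Local Open Scope ring_scope.
Local Open Scope classical_set_scope.

Lemma fsbig_cond (A : set form) (P : form -> bool) (F : form -> int) :
  \sum_(Q \in A `&` [set Q | P Q]) F Q = \sum_(Q \in A) (P Q)%:R * F Q.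
Proof.
rewrite fsbig_mkcondr; apply: eq_fsbigr => Q _.
have -> : (Q \in [set Q | P Q]) = P Q by apply/idP/idP; rewrite inE.
by case: (P Q); rewrite ?mul1r ?mul0r.
Qed.

Variable p : nat.
Hypotheses (p_prime : prime p) (p_odd : odd p).

Let p_gt0 : 0 < p%:Z.
Proof. by rewrite ltz_nat prime_gt0. Qed.

Let p_neq0 : p%:Z != 0.
Proof. by rewrite gt_eqF. Qed.

(* In the next two lemmas, forms of discriminant D are pulled back by the
   matrices (p 0; 0 1) and (1 j; 0 p) of determinant p. *)
Lemma class_sum_infinity (D : int) :
  class_sum D = \sum_(Q \in indef_forms (D * p%:Z ^+ 2))
    ((p%:Z ^+ 2 %| Q.1.1)%Z && (p %| Q.1.2)%Z)%:R * Q.2.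
Proof.
rewrite -fsbig_cond.
pose h (Q : form) : form := (p%:Z ^+ 2 * Q.1.1, p%:Z * Q.1.2, Q.2).
rewrite (reindex_fsbig h (indef_forms D)); first by apply: eq_fsbigr.
have p2_gt0 : 0 < p%:Z ^+ 2 by rewrite exprn_gt0.
split.
- move=> [[a b] c] [/= dQ a0 c0]; split; last by apply/andP; split; apply/dvdz_mulr/dvdzz.
  by split=> //=; [rewrite -dQ; ring | rewrite pmulr_rlt0].
- move=> [[a b] c] [[a' b'] c'] _ _ [/mulfI ea /mulfI eb ->].
  by rewrite ea ?eb// expf_neq0.
- move=> [[a b] c] [[dQ a0 c0] /= /andP[/dvdzP[a1 a1E] /dvdzP[b1 b1E]]].
  exists (a1, b1, c); last by rewrite /h /= a1E b1E [a1 * _]mulrC [b1 * _]mulrC.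
  split=> //=; last by move: a0; rewrite /= a1E pmulr_llt0.
  apply: (mulIf (expf_neq0 2 p_neq0)); rewrite -dQ /= a1E b1E; ring.
Qed.

Lemma cycle_sum_finite (D : int) (j : nat) :
  cycle_sum id D j%:Z p%:Z = \sum_(Q \in indef_forms (D * p%:Z ^+ 2))
    ((p %| Q.1.2 - 2 * Q.1.1 * j%:Z)%Z
     && (p%:Z ^+ 2 %| Q.2 - Q.1.2 * j%:Z + Q.1.1 * j%:Z ^+ 2)%Z)%:R * Q.2.
Proof.
rewrite -fsbig_cond /cycle_sum.
pose h (Q : form) : form :=
  (Q.1.1, 2 * Q.1.1 * j%:Z + p%:Z * Q.1.2, form_eval Q j%:Z p%:Z).
rewrite [RHS](reindex_fsbig h (cycle_forms D j%:Z p%:Z)); first by apply: eq_fsbigr.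
split.
- move=> [[a b] c] [/= dQ a0 Q0]; split.
    by split=> //=; rewrite -dQ; ring.
  apply/andP; split; apply/dvdzP; [exists b | exists c]; rewrite /=; ring.
- move=> [[a b] c] [[a' b'] c'] _ _ [<-] /addrI/(mulfI p_neq0) <-.
  by move=> /addrI/(mulIf (expf_neq0 2 p_neq0)) ->.
- move=> [[a b] c] [[/= dQ a0 c0] /andP[/dvdzP[b1 b1E] /dvdzP[c1 c1E]]].
  have bE : b = 2 * a * j%:Z + p%:Z * b1.
    by rewrite [_ * b1]mulrC -b1E; ring.
  have cE : c = a * j%:Z ^+ 2 + b1 * j%:Z * p%:Z + c1 * p%:Z ^+ 2.
    by rewrite -c1E bE; ring.
  exists (a, b1, c1); last by rewrite /h /= -bE -cE.
  split=> //=; last by rewrite -cE.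
  apply: (mulIf (expf_neq0 2 p_neq0)); rewrite -dQ bE cE; ring.
Qed.

(** Sum over the p + 1 pullbacks. The point at infinity gives S(D) and each j/p gives p^2 S(D), by
    constancy, for a total of (1 + p^3) S(D). Regrouped by forms of discriminant D p^2, which p^3
    divides, the same total is evaluated by [hecke_count]. *)
Lemma hecke_relation (D : int) (D_nsq : forall b : int, b ^+ 2 != D) :
    (p %| D)%Z ->
  (1 + p%:Z ^+ 3) * class_sum D = class_sum (D * p%:Z ^+ 2)
    + p%:Z * \sum_(Q \in indef_forms (D * p%:Z ^+ 2))
        [&& (p%:Z ^+ 2 %| Q.1.1)%Z, (p%:Z ^+ 2 %| Q.1.2)%Z & (p%:Z ^+ 2 %| Q.2)%Z]%:R * Q.2.
Proof.
move=> pD.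
have -> : (1 + p%:Z ^+ 3) * class_sum D
    = class_sum D + \sum_(j < p) cycle_sum id D (j : nat)%:Z p%:Z.
  under eq_bigr => j _ do rewrite cycle_sum_id// ?prime_gt0//.
  by rewrite sumr_const card_ord -mulr_natr natz; ring.
have Wfin := indef_forms_finite (D * p%:Z ^+ 2).
rewrite (eq_bigr _ (fun (j : 'I_p) _ => etrans (cycle_sum_finite D j) (fsbig_finite _ _ Wfin))).
rewrite exchange_big/= class_sum_infinity mulr_fsumr {1}/class_sum.
rewrite !fsbig_finite// -!big_split/= !big_seq.
apply: eq_bigr => -[[a b] c]; rewrite in_fset_set// => /set_mem [/= dQ _ _].
have dvdD : (p%:Z ^+ 3 %| b ^+ 2 - 4 * a * c)%Z by rewrite dQ exprS dvdz_mul.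
rewrite -mulr_suml -natr_sum -mulrDl -natrD.
by rewrite (hecke_count p_prime p_odd dvdD) natrD natrM mulrDl mul1r -mulrA natz.
Qed.

Lemma class_sum_scale (D : int) :
  \sum_(Q \in indef_forms (D * p%:Z ^+ 4))
     [&& (p%:Z ^+ 2 %| Q.1.1)%Z, (p%:Z ^+ 2 %| Q.1.2)%Z & (p%:Z ^+ 2 %| Q.2)%Z]%:R * Q.2
  = p%:Z ^+ 2 * class_sum D.
Proof.
rewrite -fsbig_cond mulr_fsumr.
pose h (Q : form) : form :=
  (p%:Z ^+ 2 * Q.1.1, p%:Z ^+ 2 * Q.1.2, p%:Z ^+ 2 * Q.2).
rewrite (reindex_fsbig h (indef_forms D)); first by apply: eq_fsbigr.
have p2_gt0 : 0 < p%:Z ^+ 2 by rewrite exprn_gt0.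
have p2_neq0 : p%:Z ^+ 2 != 0 by rewrite gt_eqF.
split.
- move=> [[a b] c] [/= dQ a0 c0]; split; last by apply/and3P; split; apply/dvdz_mulr/dvdzz.
  by split=> //=; [rewrite -dQ; ring | rewrite pmulr_rlt0 | rewrite pmulr_rgt0].
- by move=> [[a b] c] [[a' b'] c'] _ _ [/(mulfI p2_neq0)-> /(mulfI p2_neq0)-> /(mulfI p2_neq0)->].
- move=> [[a b] c] [[dQ a0 c0] /= /and3P[/dvdzP[a1 a1E] /dvdzP[b1 b1E] /dvdzP[c1 c1E]]].
  exists (a1, b1, c1); last by rewrite /h /= a1E b1E c1E ![_ * p%:Z ^+ 2]mulrC.
  split=> /=; last 2 first.
  + by move: a0; rewrite /= a1E pmulr_llt0.
  + by move: c0; rewrite /= c1E pmulr_lgt0.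
  by apply: (mulIf (expf_neq0 4 p_neq0)); rewrite -dQ /= a1E b1E c1E; ring.
Qed.

(** A form divisible by p^2 has discriminant divisible by p^4, which D p^2 is not. *)
Lemma class_sum_scale0 (D : int) : ~~ (p%:Z ^+ 2 %| D)%Z ->
  \sum_(Q \in indef_forms (D * p%:Z ^+ 2))
     [&& (p%:Z ^+ 2 %| Q.1.1)%Z, (p%:Z ^+ 2 %| Q.1.2)%Z & (p%:Z ^+ 2 %| Q.2)%Z]%:R * Q.2
  = 0.
Proof.
move=> npD; rewrite fsbig1// => -[[a b] c] [/= dQ _ _].
have [/and3P[/dvdzP[a1 a1E] /dvdzP[b1 b1E] /dvdzP[c1 c1E]]|] := boolP [&& _, _ & _];
  last by rewrite mul0r.
case/negP: npD; apply/dvdzP; exists (b1 ^+ 2 - 4 * a1 * c1).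
by apply: (mulIf (expf_neq0 2 p_neq0)); rewrite -dQ a1E b1E c1E; ring.
Qed.

(** With S_k = S(N p^(2k+1)), the Hecke relation reads S_(k+2) = (1 + p^3) S_(k+1) - p^3 S_k, and
    S_1 = (1 + p^3) S_0 because p^2 does not divide N p. The recurrence has order two, so the
    induction carries two consecutive values. *)
Lemma class_sum_prime_power (N : int) (k : nat) :
    (forall b : int, b ^+ 2 != N * p%:Z) -> ~~ (p %| N)%Z ->
    class_sum (N * p%:Z ^+ (2 * k).+1)
  = (\sum_(i < k.+1) p%:Z ^+ (3 * i)) * class_sum (N * p%:Z).
Proof.
move=> nsq npN.
have nsqk m (b : int) : b ^+ 2 != N * p%:Z ^+ (2 * m).+1.
  elim: m b => [|m IHm] b; first by rewrite expr1.
  apply/eqP => bE.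
  have /dvdzP[b1 b1E] : (p %| b)%Z.
    have := Euclid_dvdzM p_prime b b; rewrite orbb => <-.
    by rewrite -expr2 bE dvdz_mull// exprS dvdz_mulr.
  case/eqP: (IHm b1); apply: (mulIf (expf_neq0 2 p_neq0)).
  by rewrite -exprMn -b1E bE -mulrA -exprD; congr (_ * _ ^+ _); lia.
suff: class_sum (N * p%:Z ^+ (2 * k).+1)
  = (\sum_(i < k.+1) p%:Z ^+ (3 * i)) * class_sum (N * p%:Z) /\
  class_sum (N * p%:Z ^+ (2 * k.+1).+1)
  = (\sum_(i < k.+2) p%:Z ^+ (3 * i)) * class_sum (N * p%:Z) by case.
elim: k => [|k [IHk IHk1]].
  rewrite !big_ord_recl !big_ord0 /= !expr1; split; first by ring.
  have := hecke_relation (nsqk 0%N); rewrite expr1 dvdz_mull// => /(_ isT).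
  rewrite class_sum_scale0 ?mulr0 ?addr0 -?mulrA -?exprS; last first.
    by rewrite expr2 dvdz_mul2r.
  by move=> <-; rewrite /bump /=; ring.
split=> //.
have pDk : (p %| N * p%:Z ^+ (2 * k.+1).+1)%Z by rewrite exprS dvdz_mull// dvdz_mulr.
have := hecke_relation (nsqk k.+1) pDk.
have NpM i j : N * p%:Z ^+ i * p%:Z ^+ j = N * p%:Z ^+ (i + j) by rewrite -mulrA -exprD.
have E1 : N * p%:Z ^+ (2 * k.+1).+1 * p%:Z ^+ 2 = N * p%:Z ^+ (2 * k.+2).+1.
  by rewrite -mulrA -exprD; congr (_ * _ ^+ _); lia.
have E2 : N * p%:Z ^+ (2 * k.+1).+1 * p%:Z ^+ 2 = N * p%:Z ^+ (2 * k).+1 * p%:Z ^+ 4.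
  by rewrite !NpM; congr (_ * _ ^+ _); lia.
rewrite [in X in _ = _ + p%:Z * X]E2 class_sum_scale E1 => rel.
have {rel}-> : class_sum (N * p%:Z ^+ (2 * k.+2).+1) =
    (1 + p%:Z ^+ 3) * class_sum (N * p%:Z ^+ (2 * k.+1).+1)
    - p%:Z ^+ 3 * class_sum (N * p%:Z ^+ (2 * k).+1) by rewrite rel; ring.
have recr m : \sum_(i < m.+1) p%:Z ^+ (3 * i) =
    \sum_(i < m) p%:Z ^+ (3 * i) + p%:Z ^+ (3 * m) by rewrite big_ord_recr.
rewrite IHk IHk1 !recr (_ : (3 * k.+2 = 3 + 3 * k.+1)%N) ?exprD; last by lia.
ring.
Qed.

End HeckeRelation.

(** * Divisor sums over triangular numbers *)

Section TriangularSums.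
Local Open Scope ring_scope.
Local Open Scope classical_set_scope.

Definition tri (j : nat) : nat := (j * j.+1)./2.

Lemma tri_double (j : nat) : ((tri j).*2 = j * j.+1)%N.
Proof. by rewrite /tri; have := odd_double_half (j * j.+1); rewrite oddM /=; case: (odd j). Qed.

Definition sigma (n : nat) : nat := \sum_(d <- divisors n) d.

(** Here b is odd, so b^2 = 8 tri j + 1 with b = 2j + 1 up to sign, whence the factor 2. Then -ac =
    2(m - tri j) + 1, and c runs over its positive divisors. The weight [w] serves both the theta
    product (w = 1) and the recurrence for [sigma]. *)
Lemma sum_indef_theta (m : nat) (w : int -> int) :
  \sum_(Q \in indef_forms (8 * m + 5)%N%:Z) w (Q.1.2 ^+ 2) * Q.2
  = 2 * \sum_(j < m.+1 | (tri j <= m)%N)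
          w (8 * tri j + 1)%N%:Z * (sigma (2 * (m - tri j) + 1)%N)%:Z.
Proof.
set D := (8 * m + 5)%N%:Z; set F := fun Q : form => w (Q.1.2 ^+ 2) * Q.2.
have Wfin := indef_forms_finite D.
have b_neq0 (Q : form) : indef_forms D Q -> Q.1.2 != 0.
  by case: Q => [[a b] c] [/= dQ _ _]; apply/eqP => b0; move: dQ; rewrite b0 /D; lia.
pose bneg (Q : form) : form := let: (a, b, c) := Q in (a, - b, c).
have bnegK : cancel bneg bneg by case=> [[a b] c] /=; rewrite opprK.
rewrite (fsbigID [set Q : form | 0 < Q.1.2] (indef_forms D)) //=.
have -> : \sum_(Q \in indef_forms D `&` ~` [set Q : form | 0 < Q.1.2]) F Q
    = \sum_(Q \in indef_forms D `&` [set Q : form | 0 < Q.1.2]) F Q.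
  rewrite [LHS](reindex_cancel (h := bneg) (h' := bneg)
    (P := indef_forms D `&` [set Q : form | 0 < Q.1.2])) //.
  - by apply: eq_fsbigr => -[[a b] c] _; rewrite /F /= sqrrN.
  - move=> [[a b] c] [[/= dQ a0 c0] b0]; split=> /=; last by move: b0; rewrite /=; lia.
    by split=> //=; rewrite -dQ; ring.
  - move=> [[a b] c] [WQ b0]; have := b_neq0 _ WQ; move: WQ b0 => [/= dQ a0 c0] b0 bn0.
    by split; [split=> //=; rewrite -dQ; ring | move: b0 bn0; rewrite /=; lia].
suff -> : \sum_(Q \in indef_forms D `&` [set Q : form | 0 < Q.1.2]) F Q
    = \sum_(j < m.+1 | (tri j <= m)%N)
        w (8 * tri j + 1)%N%:Z * (sigma (2 * (m - tri j) + 1)%N)%:Z.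
  by rewrite mulrDl mul1r.
pose n (j : nat) := (2 * (m - tri j) + 1)%N.
pose js := [seq j <- iota 0 m.+1 | (tri j <= m)%N].
pose jd := [seq (j, d) | j <- js, d <- divisors (n j)].
pose h (x : nat * nat) : form := (- (n x.1 %/ x.2)%N%:Z, (2 * x.1 + 1)%N%:Z, x.2%:Z).
have jd_uniq : uniq jd.
  apply: allpairs_uniq_dep => [|j _|[j d] [j' d'] _ _ /= [-> ->]] //.
  - by rewrite filter_uniq// iota_uniq.
  - exact: divisors_uniq.
have n_gt0 (j : nat) : (0 < n j)%N by rewrite /n addn1.
have jdP (j d : nat) : ((j, d) \in jd) = (tri j <= m)%N && (d %| n j)%N.
  apply/idP/idP => [/allpairsPdep[j' [d' [+ + [-> ->]]]]|/andP[jm dn]].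
    by rewrite mem_filter => /andP[-> _]; rewrite -dvdn_divisors.
  apply/allpairsPdep; exists j, d; split=> //; last by rewrite -dvdn_divisors.
  by rewrite mem_filter jm mem_iota; have := tri_double j; nia.
have tri_sqr (j : nat) : ((2 * j + 1) ^ 2 = 8 * tri j + 1)%N.
  by have := tri_double j; nia.
have tri_sqrz (j : nat) : (2 * j + 1)%N%:Z ^+ 2 = (8 * tri j + 1)%N%:Z.
  by rewrite -tri_sqr; lia.
rewrite (reindex_fsbig h [set` jd]).
  rewrite -fsbig_seq// big_allpairs_dep big_filter.
  rewrite -(big_mkord (fun j => (tri j <= m)%N)
    (fun j => w (8 * tri j + 1)%N%:Z * (sigma (2 * (m - tri j) + 1)%N)%:Z)).
  apply: eq_bigr => j _; rewrite /F /= /sigma -mulr_sumr tri_sqrz.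
  by congr (_ * _); rewrite (big_morph _ PoszD (erefl _)).
split.
- move=> [j d] /=; rewrite jdP => /andP[jm dn].
  have d0 : (0 < d)%N := dvdn_gt0 (n_gt0 j) dn.
  have nd := divnK dn; have q0 : (0 < n j %/ d)%N by rewrite divn_gt0// dvdn_leq.
  split; last by rewrite /h /=; lia.
  split; rewrite /h /=; try lia.
  rewrite tri_sqrz /D; move: nd; rewrite {2}/n; move: (n j %/ d)%N => q nd.
  have : q%:Z * d%:Z = (2 * (m - tri j) + 1)%N%:Z by rewrite -nd; lia.
  lia.
- move=> [j d] [j' d'] _ _ [] _ jj dd.
  by congr (_, _); lia.
- move=> [[a b] c] [[/= dQ a0 c0] b0]; rewrite /= in b0.
  have b_odd : exists j : nat, b = (2 * j + 1)%N%:Z.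
    exists (absz b)./2; have := odd_double_half (absz b).
    have : odd (absz b); last by lia.
    apply/negPn/negP => /negPf b_even; have := odd_double_half (absz b).
    rewrite b_even add0n; move: (absz b)./2 => k kE.
    by move: dQ; rewrite (_ : b = 2 * k%:Z) ?/D; [rewrite exprMn; lia | lia].
  have [j jE] := b_odd; exists (j, absz c).
    rewrite /= jdP; move: dQ; rewrite jE tri_sqrz /D => dQ.
    have ac : - a * c = (2 * (m%:Z - (tri j)%:Z) + 1) by lia.
    have ac_gt0 : 0 < - a * c by rewrite mulr_gt0//; lia.
    have jm : (tri j <= m)%N by lia.
    rewrite jm /=; apply/dvdnP; exists (absz a); rewrite /n; nia.
  rewrite /h /=; move: dQ; rewrite jE tri_sqrz /D => dQ.
  have ac : - a * c = (2 * (m%:Z - (tri j)%:Z) + 1) by lia.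
  have ac_gt0 : 0 < - a * c by rewrite mulr_gt0//; lia.
  have jm : (tri j <= m)%N by lia.
  have -> : n j = (absz a * absz c)%N by rewrite /n; nia.
  rewrite mulnK; last by lia.
  by congr (_, _, _); lia.
Qed.

Lemma class_sum_theta (m : nat) : class_sum (8 * m + 5)%N%:Z =
  2 * \sum_(j < m.+1 | (tri j <= m)%N) (sigma (2 * (m - tri j) + 1)%N)%:Z.
Proof.
transitivity (\sum_(Q \in indef_forms (8 * m + 5)%N%:Z) 1 * Q.2).
  by apply: eq_fsbigr => Q _; rewrite mul1r.
rewrite (sum_indef_theta m (fun=> 1)); congr (_ * _).
by apply: eq_bigr => j _; rewrite mul1r.
Qed.

Lemma nonsquare_5mod8 (m : nat) (b : int) : b ^+ 2 != (8 * m + 5)%N%:Z.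
Proof.
apply/eqP => bE; have := divz_eq b 4; have := modz_ge0 b (isT : 4 != 0 :> int).
have := ltz_pmod b (isT : 0 < 4 :> int).
move: (b %/ 4)%Z (b %% 4)%Z => k r r4 r0 kr.
have : r = 0 \/ r = 1 \/ r = 2 \/ r = 3 by lia.
have : b ^+ 2 = 16 * k ^+ 2 + 8 * (k * r) + r ^+ 2 by rewrite kr; ring.
by rewrite bE => E [|[|[]]] re; move: E; rewrite re; lia.
Qed.

(** On forms of discriminant D, (D - 5b^2) c = -4 (a c^2 + b^2 c), whose sum vanishes by the cubic
    moment. For b^2 = 8 tri j + 1 the weight D - 5b^2 is 8 (m - 5 tri j). *)
Lemma sigma_recurrence (m : nat) :
  \sum_(j < m.+1 | (tri j <= m)%N)
    (m%:Z - 5 * (tri j)%:Z) * (sigma (2 * (m - tri j) + 1)%N)%:Z = 0.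
Proof.
set D := (8 * m + 5)%N%:Z.
have := sum_indef_theta m (fun x => D - 5 * x).
have -> : \sum_(Q \in indef_forms D) (D - 5 * Q.1.2 ^+ 2) * Q.2 = 0.
  transitivity (- 4 * \sum_(Q \in indef_forms D) (Q.1.1 * Q.2 ^+ 2 + Q.1.2 ^+ 2 * Q.2)).
    rewrite mulr_fsumr; apply: eq_fsbigr => -[[a b] c] /set_mem [/= dQ _ _].
    by rewrite -dQ /=; ring.
  by rewrite (sum_indef_cubic (nonsquare_5mod8 m)) mulr0.
have -> : \sum_(j < m.+1 | (tri j <= m)%N)
    (D - 5 * (8 * tri j + 1)%N%:Z) * (sigma (2 * (m - tri j) + 1)%N)%:Z
  = 8 * \sum_(j < m.+1 | (tri j <= m)%N)
    (m%:Z - 5 * (tri j)%:Z) * (sigma (2 * (m - tri j) + 1)%N)%:Z.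
  rewrite mulr_sumr; apply: eq_bigr => j _; rewrite mulrA; congr (_ * _).
  by rewrite /D; lia.
by move: (\sum_(j < _ | _) _) => x; lia.
Qed.

End TriangularSums.

(** * Truncated power series and Gauss's identity *)

Section TruncatedSeries.
Local Open Scope ring_scope.
Variable R : comNzRingType.
Implicit Types (p q r u : {poly R}) (K : nat).

Definition eqX K p q : Prop := exists r, p = q + r * 'X^K.

Lemma eqX_refl K p : eqX K p p.
Proof. by exists 0; rewrite mul0r addr0. Qed.

Lemma eqX_sym K p q : eqX K p q -> eqX K q p.
Proof. by move=> [r ->]; exists (- r); ring. Qed.

Lemma eqX_trans K q p r : eqX K p q -> eqX K q r -> eqX K p r.
Proof. by move=> [u ->] [v ->]; exists (u + v); ring. Qed.

Lemma eqX_add K p q p' q' : eqX K p q -> eqX K p' q' -> eqX K (p + p') (q + q').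
Proof. by move=> [u ->] [v ->]; exists (u + v); ring. Qed.

Lemma eqX_mul K p q p' q' : eqX K p q -> eqX K p' q' -> eqX K (p * p') (q * q').
Proof. by move=> [u ->] [v ->]; exists (u * q' + q * v + u * v * 'X^K); ring. Qed.

Lemma eqX_mull K r p q : eqX K p q -> eqX K (r * p) (r * q).
Proof. exact/eqX_mul/eqX_refl. Qed.

Lemma eqX_exp K n p q : eqX K p q -> eqX K (p ^+ n) (q ^+ n).
Proof.
move=> pq; elim: n => [|n IHn]; first exact: eqX_refl.
by rewrite !exprS; apply: eqX_mul.
Qed.

Lemma eqX_prod K (I : Type) (s : seq I) (P : pred I) (F G : I -> {poly R}) :
  (forall i, P i -> eqX K (F i) (G i)) ->
  eqX K (\prod_(i <- s | P i) F i) (\prod_(i <- s | P i) G i).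
Proof.
move=> FG; elim/big_ind2: _ => //; first exact: eqX_refl.
by move=> p q p' q'; apply: eqX_mul.
Qed.

Lemma eqX_prod1 K (I : Type) (s : seq I) (P : pred I) (F : I -> {poly R}) :
  (forall i, P i -> eqX K (F i) 1) -> eqX K (\prod_(i <- s | P i) F i) 1.
Proof. by move=> /(eqX_prod s); rewrite big1_eq. Qed.

Lemma eqX_leq K K' p q : (K' <= K)%N -> eqX K p q -> eqX K' p q.
Proof.
by move=> leK [r ->]; exists (r * 'X^(K - K')); rewrite -mulrA -exprD subnK.
Qed.

Lemma eqX_coefP K p q : eqX K p q <-> forall i, (i < K)%N -> p`_i = q`_i.
Proof.
split=> [[r ->] i iK|pq]; first by rewrite coefD coefMXn iK addr0.
exists (drop_poly K p - drop_poly K q); rewrite mulrBl.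
rewrite -{1}(poly_take_drop K p) -{1}(poly_take_drop K q).
suff -> : take_poly K p = take_poly K q by ring.
by apply/polyP => i; rewrite !coef_take_poly; case: ifP => // /pq.
Qed.

Lemma eqX_comp K d p q : eqX K p q -> eqX (d * K) (p \Po 'X^d) (q \Po 'X^d).
Proof.
move=> [r ->]; exists (r \Po 'X^d).
by rewrite comp_polyD comp_polyM comp_Xn_poly -exprM.
Qed.

(** Geometric series in w = 1 - u: w is divisible by X, so w^K is 0 modulo X^K. *)
Lemma eqX_inverse K u : u`_0 = 1 -> exists v, eqX K (u * v) 1.
Proof.
move=> u0; pose w := 1 - u.
have [t wE] : exists t, w = t * 'X.
  have [] := (eqX_coefP 1 w 0).2 _; last by move=> t; rewrite add0r; exists t.
  by case=> // _; rewrite coefB coef1 u0 subrr coef0.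
exists (\sum_(i < K) w ^+ i); exists (- t ^+ K).
have -> : u = 1 - w by rewrite /w; ring.
by rewrite -(opprB w 1) mulNr -subrX1 wE exprMn; ring.
Qed.

Lemma eqX_cancel K u p q : u`_0 = 1 -> eqX K (u * p) (u * q) -> eqX K p q.
Proof.
move=> /(eqX_inverse K)[v uv] upq.
apply: (@eqX_trans _ (v * (u * p))); last apply: (@eqX_trans _ (v * (u * q))).
- rewrite mulrA [v * u]mulrC -{1}[p]mul1r; apply: eqX_mul; last exact: eqX_refl.
  exact: eqX_sym.
- exact: eqX_mull.
- rewrite mulrA [v * u]mulrC -[X in eqX _ _ X]mul1r; apply: eqX_mul => //.
  exact: eqX_refl.
Qed.

End TruncatedSeries.

Section GaussIdentity.
Local Open Scope ring_scope.
Variable R : comNzRingType.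

Definition psi n : {poly R} := \sum_(j < n) 'X^(tri j).

Definition odd_prod n : {poly R} := \prod_(k < n) (1 - 'X^(2 * k + 1)).
Definition even_prod n : {poly R} := \prod_(k < n) (1 - 'X^(2 * k + 2)).

(* Shanks' finite form of Gauss's identity; for s >= 1 the terms on the right
   are divisible by X^(2n+1). *)
Lemma shanks n : odd_prod n * psi (2 * n) =
  \sum_(s < n) odd_prod s * (\prod_(s <= k < n) (1 - 'X^(2 * k + 2)))
    * 'X^(s * (2 * n + 1)).
Proof.
elim: n => [|n IHn]; first by rewrite /psi !big_ord0 mulr0.
have -> : psi (2 * n.+1) = psi (2 * n) + 'X^(n * (2 * n + 1))
    + 'X^(n * (2 * n + 1) + (2 * n + 1)).
  rewrite /psi mulnS add2n !big_ord_recr /=.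
  by congr (_ + 'X^_ + 'X^_); [have := tri_double (2 * n) | have := tri_double (2 * n).+1]; lia.
have OS s : odd_prod s.+1 = odd_prod s * (1 - 'X^(2 * s + 1)).
  by rewrite /odd_prod big_ord_recr.
pose w s := odd_prod s * (\prod_(s <= k < n) (1 - 'X^(2 * k + 2)) : {poly R}).
(* Telescoping certificate: the s-th summand for n + 1 minus (1 - X^(2n+1)) times the one for n is t
   (s + 1) - t s. The factor 1 - X^(2s) makes t 0 = 0. *)
pose t s : {poly R} := w s * (1 - 'X^(2 * s)) * 'X^(s * (2 * n + 1)).
have telescope i : (i <= n)%N ->
    \sum_(s < i) w s * (1 - 'X^(2 * n + 2)) * 'X^(s * (2 * n.+1 + 1))
    = (1 - 'X^(2 * n + 1)) * (\sum_(s < i) w s * 'X^(s * (2 * n + 1))) + t i.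
  elim: i => [|i IHi] ltin.
    by rewrite /t !(big_ord0, muln0, expr0, subrr, mulr0, mul0r, addr0).
  rewrite !big_ord_recr /= (IHi (ltnW ltin)) /t.
  have wi : w i * (1 - 'X^(2 * i + 1)) = w i.+1 * (1 - 'X^(2 * i.+1)).
    rewrite /w OS [in LHS]big_ltn//.
    by rewrite (_ : (2 * i.+1 = 2 * i + 2)%N); [ring | lia].
  have -> : w i.+1 * (1 - 'X^(2 * i.+1)) * 'X^(i.+1 * (2 * n + 1))
      = w i * (1 - 'X^(2 * i + 1)) * 'X^(i.+1 * (2 * n + 1)) by rewrite wi.
  rewrite (_ : (i * (2 * n.+1 + 1) = i * (2 * n + 1) + 2 * i)%N); last by lia.
  rewrite (_ : (i.+1 * (2 * n + 1) = i * (2 * n + 1) + (2 * n + 1))%N); last by lia.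
  rewrite (_ : (2 * n + 2 = (2 * n + 1) + 1)%N); last by lia.
  by rewrite !exprD; ring.
have -> : \sum_(s < n.+1) odd_prod s * (\prod_(s <= k < n.+1) (1 - 'X^(2 * k + 2)))
      * 'X^(s * (2 * n.+1 + 1))
    = \sum_(s < n.+1) w s * (1 - 'X^(2 * n + 2)) * 'X^(s * (2 * n.+1 + 1)).
  apply: eq_bigr => s _; congr (_ * _); rewrite /w -mulrA; congr (_ * _).
  by rewrite big_nat_recr//= -ltnS.
rewrite big_ord_recr /= telescope// !mulrDr OS.
rewrite -[odd_prod n * _ * psi _]mulrA [_ * psi _]mulrC [odd_prod n * (_ * _)]mulrC.
rewrite -[psi _ * _ * _]mulrA [_ * odd_prod n]mulrC mulrA [psi _ * _]mulrC IHn.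
rewrite [(\sum_(s < n) _) * _]mulrC -!addrA; congr (_ + _).
have wn : w n = odd_prod n by rewrite /w big_geq// mulr1.
rewrite /t wn.
rewrite (_ : (n * (2 * n.+1 + 1) = n * (2 * n + 1) + 2 * n)%N); last by lia.
rewrite (_ : (2 * n + 2 = 2 * n + 1 + 1)%N); last by lia.
by rewrite !exprD; ring.
Qed.

Lemma eqX_psi n m : (n <= m)%N -> eqX n (psi m) (psi n).
Proof.
move=> /subnKC <-; elim: (m - n)%N => [|k IHk]; first by rewrite addn0; apply: eqX_refl.
rewrite addnS /psi big_ord_recr /= -[X in eqX _ _ X]addr0; apply: eqX_add => //.
have le_tri : (n <= tri (n + k))%N by have := tri_double (n + k); nia.
by exists ('X^(tri (n + k) - n)); rewrite add0r -exprD subnK.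
Qed.

Lemma odd_prod_trunc n m : (n <= m)%N -> eqX n (odd_prod m) (odd_prod n).
Proof.
move=> /subnKC <-; elim: (m - n)%N => [|k IHk]; first by rewrite addn0; apply: eqX_refl.
rewrite addnS /odd_prod big_ord_recr /= -[X in eqX _ _ X]mulr1; apply: eqX_mul => //.
exists (- 'X^(2 * (n + k) + 1 - n)); rewrite mulNr -exprD subnK//; lia.
Qed.

Lemma even_prod_trunc n m : (n <= m)%N -> eqX n (even_prod m) (even_prod n).
Proof.
move=> /subnKC <-; elim: (m - n)%N => [|k IHk]; first by rewrite addn0; apply: eqX_refl.
rewrite addnS /even_prod big_ord_recr /= -[X in eqX _ _ X]mulr1; apply: eqX_mul => //.
exists (- 'X^(2 * (n + k) + 2 - n)); rewrite mulNr -exprD subnK//; lia.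
Qed.

(** Modulo X^n only the term s = 0 of Shanks' sum survives, and it is [even_prod n]. *)
Lemma gauss n : eqX n (odd_prod n * psi n) (even_prod n).
Proof.
apply: (eqX_trans (q := odd_prod n * psi (2 * n))).
  by apply/eqX_mull/eqX_sym/eqX_psi; lia.
rewrite shanks; case: n => [|n]; first by exists (0 - even_prod 0); rewrite big_ord0; ring.
rewrite big_ord_recl /= mul0n expr0 mulr1 /odd_prod big_ord0 mul1r big_mkord.
rewrite -/(even_prod _) -[X in eqX _ _ X]addr0; apply/eqX_add/(_ : eqX _ _ 0).
  exact: eqX_refl.
elim/big_ind: _ => [|p q p0 q0|s _]; first exact: eqX_refl.
  by rewrite -[X in eqX _ _ X]addr0; apply: eqX_add.
set u := _ * (\prod_(_ <= _ < _) _).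
exists (u * 'X^(bump 0 s * (2 * n.+1 + 1) - n.+1)); rewrite add0r -mulrA -exprD subnK//.
by rewrite /bump /=; nia.
Qed.

End GaussIdentity.

(** * The generating function of pod *)

Section PodSeries.
Local Open Scope ring_scope.
Variable R : comNzRingType.

(** The factor of the part i.+1 in the generating function taken at -q, multiplicities being cut at
    n. At -q the product becomes [odd_prod] over [even_prod], that is 1 / psi(q). *)
Definition pod_factor n i : {poly R} :=
  \sum_(k < n.+1) (odd i.+1 ==> (k <= 1)%N)%:R * (- 'X) ^+ (k * i.+1).

Definition pod_poly n : {poly R} := \prod_(i < n) pod_factor n i.

(** Expanding the product yields one term for each multiplicity function in {ffun 'I_n -> 'I_n.+1},
    the very encoding used by [pod]. *)
Lemma pod_poly_coef n : (pod_poly n)`_n = (-1) ^+ n * (pod n)%:R.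
Proof.
rewrite /pod_poly /pod_factor bigA_distr_bigA /= coef_sum /pod -sum1_card.
rewrite natr_sum mulr_sumr [RHS]big_mkcond /=; apply: eq_bigr => m _.
rewrite big_split /= prodrXr inE /is_partition.
have -> : \prod_(i < n) ((odd i.+1 ==> (m i <= 1)%N)%:R : {poly R})
    = (odd_parts_distinct m)%:R.
  have [/forallP oP|/forallPn[i]] := boolP (odd_parts_distinct m).
    by rewrite big1// => i _; rewrite oP.
  by rewrite (bigD1 i)//= => /negPf->; rewrite mul0r.
case: (odd_parts_distinct m); rewrite ?andbF ?mul0r ?coef0// andbT mul1r.
have -> : (- 'X : {poly R}) ^+ (\sum_(i < n) m i * i.+1)
    = ((-1) ^+ (\sum_(i < n) m i * i.+1))%:P * 'X^(\sum_(i < n) m i * i.+1).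
  by rewrite polyC_exp polyCN polyC1 -exprNn.
rewrite coefCM coefXn eq_sym; case: eqP => [->|_]; rewrite ?mulr1 ?mulr0//.
Qed.

Lemma prod_nat_parity n (g : nat -> {poly R}) :
  (\prod_(0 <= i < 2 * n | odd i.+1) g i = \prod_(k < n) g (2 * k)%N) *
  (\prod_(0 <= i < 2 * n | ~~ odd i.+1) g i = \prod_(k < n) g (2 * k).+1).
Proof.
elim: n => [|n [IHo IHe]]; first by rewrite !big_ord0 !big_geq.
have even2 : odd (2 * n) = false by rewrite oddM.
rewrite mulnS add2n !(big_ord_recr n) /= -IHo -IHe.
by split; rewrite [LHS]big_mkcond [X in _ = X * _]big_mkcond /= !big_nat_recr //= even2 /=; ring.
Qed.

Lemma pod_factor_odd n i : (i < n)%N -> odd i.+1 ->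
  pod_factor n i = 1 - 'X^(i.+1).
Proof.
case: n => // n _ oi.
have XE : (- 'X : {poly R}) ^+ i.+1 = - 'X^(i.+1).
  by rewrite exprNn -signr_odd oi expr1 mulN1r.
rewrite /pod_factor oi !big_ord_recl /= big1 => [|k _].
  by rewrite mul0n mul1n expr0 XE; ring.
by rewrite /bump /= mul0r.
Qed.

Lemma pod_factor_even n i : ~~ odd i.+1 ->
  eqX n.+1 (pod_factor n i * (1 - 'X^(i.+1))) 1.
Proof.
move=> ei; have XE : (- 'X : {poly R}) ^+ i.+1 = 'X^(i.+1).
  by rewrite exprNn -signr_odd (negPf ei) mul1r.
have -> : pod_factor n i * (1 - 'X^(i.+1)) = 1 - 'X^(i.+1 * n.+1).
  rewrite /pod_factor (negPf ei) /= mulrC exprM -[in RHS]opprB subrX1 -mulNr opprB.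
  congr (_ * _); apply: eq_bigr => k _.
  by rewrite mul1r [(_ * i.+1)%N]mulnC exprM XE.
exists (- 'X^(i.+1 * n.+1 - n.+1)); rewrite mulNr -exprD subnK//.
by rewrite leq_pmull.
Qed.

Lemma eqX_truncate_prod n m (P : pred nat) : (n <= m)%N ->
  eqX n.+1 (\prod_(0 <= i < n | P i) (1 - 'X^(i.+1)) : {poly R})
    (\prod_(0 <= i < m | P i) (1 - 'X^(i.+1))).
Proof.
move=> nm; rewrite (big_cat_nat (leq0n n) nm) /=.
rewrite -[X in eqX _ X _]mulr1; apply/eqX_mull/eqX_sym.
rewrite big_nat_cond; apply: eqX_prod1 => i /andP[/andP[ni _] _].
by exists (- 'X^(i.+1 - n.+1)); rewrite mulNr -exprD subnK.
Qed.

Lemma prod_coef0 (I : Type) (s : seq I) (P : pred I) (F : I -> {poly R}) :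
  (forall i, (F i)`_0 = 1) -> (\prod_(i <- s | P i) F i)`_0 = 1.
Proof.
move=> F1; elim/big_ind: _ => [|p q p1 q1|i _]; first by rewrite coef1.
  by rewrite coef0M p1 q1 mulr1.
exact: F1.
Qed.

Lemma one_sub_Xn_coef0 n : (0 < n)%N -> (1 - 'X^n : {poly R})`_0 = 1.
Proof. by case: n => // n _; rewrite coefB coef1 coefXn subr0. Qed.

Lemma odd_prod_coef0 n : (odd_prod R n)`_0 = 1.
Proof. by apply: prod_coef0 => i; apply: one_sub_Xn_coef0; rewrite addn1. Qed.

Lemma pod_series n : eqX n.+1 (pod_poly n * psi R n.+1) 1.
Proof.
pose f i : {poly R} := 1 - 'X^(i.+1).
have n2 : (n <= 2 * n.+1)%N by lia.
have oddE : odd_prod R n.+1 = \prod_(0 <= i < 2 * n.+1 | odd i.+1) f i.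
  by rewrite (prod_nat_parity _ f).1; apply: eq_bigr => k _; rewrite addn1.
have evenE : even_prod R n.+1 = \prod_(0 <= i < 2 * n.+1 | ~~ odd i.+1) f i.
  by rewrite (prod_nat_parity _ f).2; apply: eq_bigr => k _; rewrite addn2.
have podE : eqX n.+1 (pod_poly n * even_prod R n.+1) (odd_prod R n.+1).
  rewrite oddE evenE.
  apply: (eqX_trans (q := pod_poly n * \prod_(0 <= i < n | ~~ odd i.+1) f i)).
    exact/eqX_mull/eqX_sym/eqX_truncate_prod.
  apply: (eqX_trans (q := \prod_(0 <= i < n | odd i.+1) f i)); last first.
    exact: eqX_truncate_prod.
  rewrite /pod_poly -(big_mkord xpredT (pod_factor n)).
  rewrite (bigID (fun i => odd i.+1)) /= -mulrA -[X in eqX _ _ X]mulr1.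
  apply: eqX_mul; last first.
    by rewrite -big_split; apply: eqX_prod1 => i; apply: pod_factor_even.
  rewrite big_nat_cond [X in eqX _ _ X]big_nat_cond.
  apply: eqX_prod => i /andP[/andP[_ ltin] oi].
  by rewrite pod_factor_odd//; apply: eqX_refl.
apply: (eqX_cancel (odd_prod_coef0 n.+1)); rewrite mulr1.
rewrite mulrCA; apply: eqX_trans podE; apply: eqX_mull; exact: gauss.
Qed.

End PodSeries.

(** * The cubic norm of psi *)

Section Dissection.
Local Open Scope ring_scope.
Variable R : comNzRingType.

(** This is A of the overview. For j = 0 or 2 mod 3, [tri j] is a multiple of 3 and the division is
    exact; the remaining indices satisfy tri (3i + 1) = 9 tri i + 1 and make up q psi(q^9). *)
Definition psi_rest n : {poly R} :=
  \sum_(i < n) ('X^(tri (3 * i) %/ 3) + 'X^(tri (3 * i + 2) %/ 3)).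

Lemma psi_dissection n :
  psi R (3 * n) = (psi_rest n \Po 'X^3) + 'X * (psi R n \Po 'X^9).
Proof.
elim: n => [|n IHn]; first by rewrite /psi /psi_rest !big_ord0 !comp_poly0; ring.
have -> : psi R (3 * n.+1) =
    psi R (3 * n) + 'X^(tri (3 * n)) + 'X^(tri (3 * n + 1)) + 'X^(tri (3 * n + 2)).
  by rewrite addn1 addn2 /psi mulnS add3n !big_ord_recr.
have -> : psi_rest n.+1 = psi_rest n + ('X^(tri (3 * n) %/ 3) + 'X^(tri (3 * n + 2) %/ 3)).
  by rewrite /psi_rest big_ord_recr.
have -> : psi R n.+1 = psi R n + 'X^(tri n) by rewrite /psi big_ord_recr.
rewrite IHn !comp_polyD !comp_Xn_poly -!exprM.
have -> : (3 * (tri (3 * n) %/ 3) = tri (3 * n))%N.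
  have : (n * (3 * n).+1 = 2 * (tri (3 * n) %/ 3))%N; last by have := tri_double (3 * n); nia.
  have := tri_double (3 * n); nia.
have -> : (3 * (tri (3 * n + 2) %/ 3) = tri (3 * n + 2))%N.
  have := tri_double (3 * n + 2); nia.
have -> : (tri (3 * n + 1) = 9 * tri n + 1)%N.
  have := tri_double (3 * n + 1); have := tri_double n; nia.
by rewrite exprD; ring.
Qed.

End Dissection.

Section CubicNorm.
Local Open Scope ring_scope.
Variables (R : comNzRingType) (w : R).
Hypothesis w_root : 1 + w + w ^+ 2 = 0.

Lemma w_cubed : w ^+ 3 = 1.
Proof.
have : (w - 1) * (1 + w + w ^+ 2) = 0 by rewrite w_root mulr0.
by move=> H; apply/eqP; rewrite -subr_eq0 -H; apply/eqP; ring.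
Qed.

Lemma norm_factor (a y : {poly R}) :
  (a + y) * (a + w%:P * y) * (a + w%:P ^+ 2 * y) = a ^+ 3 + y ^+ 3.
Proof.
have s0 : 1 + w%:P + w%:P ^+ 2 = 0 :> {poly R}.
  by rewrite -polyC_exp -polyC1 -!polyCD w_root.
have -> : (a + y) * (a + w%:P * y) * (a + w%:P ^+ 2 * y) = a ^+ 3 + y ^+ 3
    + (1 + w%:P + w%:P ^+ 2) * (a ^+ 2 * y + w%:P * a * y ^+ 2 + (w%:P - 1) * y ^+ 3).
  by ring.
by rewrite s0 mul0r addr0.
Qed.

(** The product of the conjugates of p under X -> w X, a norm down to series in X^3. *)
Definition norm3 (p : {poly R}) : {poly R} :=
  p * (p \Po (w%:P * 'X)) * (p \Po ((w ^+ 2)%:P * 'X)).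

Lemma norm3M p q : norm3 (p * q) = norm3 p * norm3 q.
Proof. by rewrite /norm3 !comp_polyM; ring. Qed.

Lemma eqX_twist K (c : R) p q :
  eqX K p q -> eqX K (p \Po (c%:P * 'X)) (q \Po (c%:P * 'X)).
Proof.
move=> [r ->]; exists ((r \Po (c%:P * 'X)) * c%:P ^+ K).
by rewrite comp_polyD comp_polyM comp_Xn_poly exprMn mulrA.
Qed.

Lemma eqX_norm3 K p q : eqX K p q -> eqX K (norm3 p) (norm3 q).
Proof.
move=> pq; rewrite /norm3.
by do 2?[apply: eqX_mul]; rewrite //; apply: eqX_twist.
Qed.

Lemma one_sub_Xn_comp n (q : {poly R}) : (1 - 'X^n) \Po q = 1 - q ^+ n.
Proof. by rewrite comp_polyB comp_Xn_poly -polyC1 comp_polyC. Qed.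

(** The conjugates are 1 - w^(in) X^n for i = 0, 1, 2; the w^(in) are all 1 if 3 divides n, and are
    1, w, w^2 in some order otherwise. *)
Lemma norm3_one_sub_Xn n : norm3 (1 - 'X^n) =
  if (3 %| n)%N then (1 - 'X^n) ^+ 3 else 1 - 'X^(3 * n).
Proof.
rewrite /norm3 !one_sub_Xn_comp !exprMn -!polyC_exp -exprM.
have w3 i j : w ^+ (i + 3 * j) = w ^+ i by rewrite exprD exprM w_cubed expr1n mulr1.
have nE := divn_eq n 3; have : (n %% 3 < 3)%N by rewrite ltn_mod.
rewrite /dvdn; move: (n %% 3)%N (n %/ 3)%N nE => r k nE r3.
have [r0|[r1|r2]] : (r = 0 \/ r = 1 \/ r = 2)%N by lia.
- rewrite r0 /= [in w ^+ n](_ : n = 0 + 3 * k)%N ?w3; last by lia.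
  rewrite [in w ^+ (2 * n)](_ : 2 * n = 0 + 3 * (2 * k))%N ?w3; last by lia.
  by rewrite expr0 polyC1; ring.
- rewrite r1 /= [in w ^+ n](_ : n = 1 + 3 * k)%N ?w3; last by lia.
  rewrite [in w ^+ (2 * n)](_ : 2 * n = 2 + 3 * (2 * k))%N ?w3; last by lia.
  rewrite [(3 * n)%N]mulnC exprM expr1 polyC_exp.
  have := norm_factor 1 (- 'X^n); rewrite expr1n => H.
  transitivity (1 + (- 'X^n : {poly R}) ^+ 3); first by rewrite -H; ring.
  by ring.
- rewrite r2 /= [in w ^+ n](_ : n = 2 + 3 * k)%N ?w3; last by lia.
  rewrite [in w ^+ (2 * n)](_ : 2 * n = 1 + 3 * (2 * k + 1))%N ?w3; last by lia.
  rewrite [(3 * n)%N]mulnC exprM expr1 polyC_exp.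
  have := norm_factor 1 (- 'X^n); rewrite expr1n => H.
  transitivity (1 + (- 'X^n : {poly R}) ^+ 3); first by rewrite -H; ring.
  by ring.
Qed.

(** Factors are taken three at a time. Only the middle exponent, 3(2n + 1), is divisible by 3: its
    norm is a cube instead of 1 - X^(9(2n+1)), and the latter is supplied by the second factor on
    the left. *)
Lemma norm3_odd_prod n :
  norm3 (odd_prod R (3 * n)) * (odd_prod R n \Po 'X^9) =
  (odd_prod R (3 * n) \Po 'X^3) * (odd_prod R n \Po 'X^3) ^+ 3.
Proof.
have recr k : odd_prod R k.+1 = odd_prod R k * (1 - 'X^(2 * k + 1)).
  by rewrite /odd_prod big_ord_recr.
elim: n => [|n IHn].
  by rewrite /odd_prod !big_ord0 /norm3 -polyC1 !comp_polyC; ring.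
rewrite mulnS add3n !recr !norm3M !comp_polyM !norm3_one_sub_Xn !one_sub_Xn_comp.
have -> : (3 %| 2 * (3 * n) + 1)%N = false by lia.
have -> : (3 %| 2 * (3 * n).+1 + 1)%N by lia.
have -> : (3 %| 2 * (3 * n).+2 + 1)%N = false by lia.
rewrite -!exprM.
have -> : (9 * (2 * n + 1) = 3 * (2 * (3 * n).+1 + 1))%N by lia.
have -> : (2 * (3 * n).+1 + 1 = 3 * (2 * n + 1))%N by lia.
move: IHn; set A := norm3 _; set B := _ \Po 'X^9; set C := odd_prod _ _ \Po _.
by set D := odd_prod _ _ \Po _ => IHn; ring: IHn.
Qed.

Lemma norm3_even_prod n :
  norm3 (even_prod R (3 * n)) * (even_prod R n \Po 'X^9) =
  (even_prod R (3 * n) \Po 'X^3) * (even_prod R n \Po 'X^3) ^+ 3.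
Proof.
have recr k : even_prod R k.+1 = even_prod R k * (1 - 'X^(2 * k + 2)).
  by rewrite /even_prod big_ord_recr.
elim: n => [|n IHn].
  by rewrite /even_prod !big_ord0 /norm3 -polyC1 !comp_polyC; ring.
rewrite mulnS add3n !recr !norm3M !comp_polyM !norm3_one_sub_Xn !one_sub_Xn_comp.
have -> : (3 %| 2 * (3 * n) + 2)%N = false by lia.
have -> : (3 %| 2 * (3 * n).+1 + 2)%N = false by lia.
have -> : (3 %| 2 * (3 * n).+2 + 2)%N by lia.
rewrite -!exprM.
have -> : (9 * (2 * n + 2) = 3 * (2 * (3 * n).+2 + 2))%N by lia.
have -> : (2 * (3 * n).+2 + 2 = 3 * (2 * n + 2))%N by lia.
move: IHn; set A := norm3 _; set B := _ \Po 'X^9; set C := even_prod _ _ \Po _.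
by set D := even_prod _ _ \Po _ => IHn; ring: IHn.
Qed.

(** The twist X -> w X fixes series in X^3 and multiplies X psi(X^9) by w, so [norm_factor] applies
    to the dissection. *)
Lemma norm3_psi n : norm3 (psi R (3 * n)) =
  (psi_rest R n \Po 'X^3) ^+ 3 + ('X * (psi R n \Po 'X^9)) ^+ 3.
Proof.
have twist (c : R) d (p : {poly R}) : c ^+ d = 1 ->
    (p \Po 'X^d) \Po (c%:P * 'X) = p \Po 'X^d.
  by move=> cd; rewrite -comp_polyA comp_Xn_poly exprMn -polyC_exp cd mul1r.
have w9 : w ^+ 9 = 1 by rewrite (exprM w 3 3) w_cubed expr1n.
have w2 d : w ^+ d = 1 -> (w ^+ 2) ^+ d = 1 by rewrite exprAC => ->; rewrite expr1n.
rewrite /norm3 psi_dissection !comp_polyD !comp_polyM !comp_polyX.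
rewrite !twist ?w2 ?w_cubed//.
by rewrite -norm_factor polyC_exp; ring.
Qed.

(** By Gauss psi = E / O with E, O the even and odd products, and the norm of each is its value at
    X^3 to the fourth power over its value at X^9. Hence the norm of psi is psi(X^3)^4 / psi(X^9).
    Division is avoided by cancelling O(X^3)^4 O(X^9), of constant term 1. *)
Lemma psi_norm_identity n : eqX (3 * n)
  ((psi R n \Po 'X^9) * ((psi_rest R n \Po 'X^3) ^+ 3 + ('X * (psi R n \Po 'X^9)) ^+ 3))
  ((psi R n \Po 'X^3) ^+ 4).
Proof.
set b := psi R n \Po 'X^9; set c := psi R n \Po 'X^3.
rewrite -norm3_psi; set N := norm3 _.
set O3 := odd_prod R n \Po 'X^3; set O9 := odd_prod R n \Po 'X^9.
set E3 := even_prod R n \Po 'X^3; set E9 := even_prod R n \Po 'X^9.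
have oc : eqX (3 * n) (O3 * c) E3.
  by rewrite /O3 /c -comp_polyM; apply/eqX_comp/gauss.
have ob : eqX (3 * n) (O9 * b) E9.
  apply: (@eqX_leq _ (9 * n)); first by lia.
  by rewrite /O9 /b -comp_polyM; apply/eqX_comp/gauss.
have NE : eqX (3 * n) (norm3 (odd_prod R (3 * n)) * N) (norm3 (even_prod R (3 * n))).
  by rewrite /N -norm3M; apply/eqX_norm3/gauss.
have NO : eqX (3 * n) (norm3 (odd_prod R (3 * n)) * O9) (O3 ^+ 4).
  rewrite norm3_odd_prod exprS; apply: eqX_mul; last exact: eqX_refl.
  exact/eqX_comp/odd_prod_trunc/leq_pmull.
have NEv : eqX (3 * n) (norm3 (even_prod R (3 * n)) * E9) (E3 ^+ 4).
  rewrite norm3_even_prod exprS; apply: eqX_mul; last exact: eqX_refl.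
  exact/eqX_comp/even_prod_trunc/leq_pmull.
have comp0 (p : {poly R}) d : (0 < d)%N -> p`_0 = 1 -> (p \Po 'X^d)`_0 = 1.
  by move=> d0 p0; rewrite coef_comp_poly_Xn// dvdn0 div0n.
have O3_0 : (O3 ^+ 4 * O9)`_0 = 1.
  have o0 := odd_prod_coef0 R n.
  by rewrite !exprS expr0 !coef0M coef1 !comp0// !mulr1.
apply: (eqX_cancel O3_0).
apply: (eqX_trans (q := norm3 (odd_prod R (3 * n)) * O9 * (O9 * b) * N)).
  rewrite (_ : O3 ^+ 4 * O9 * (b * N) = O3 ^+ 4 * (O9 * b) * N); last by ring.
  by do 2?[apply: eqX_mul; last exact: eqX_refl]; apply: eqX_sym.
apply: (eqX_trans (q := (norm3 (odd_prod R (3 * n)) * N) * (O9 * E9))).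
  rewrite (_ : norm3 (odd_prod R (3 * n)) * O9 * (O9 * b) * N
    = norm3 (odd_prod R (3 * n)) * N * (O9 * (O9 * b))); last by ring.
  by do 2![apply: eqX_mull].
apply: (eqX_trans (q := norm3 (even_prod R (3 * n)) * (O9 * E9))).
  by apply: eqX_mul => //; apply: eqX_refl.
apply: (eqX_trans (q := E3 ^+ 4 * O9)).
  rewrite mulrCA mulrC; apply: eqX_mul => //; exact: eqX_refl.
rewrite (_ : O3 ^+ 4 * O9 * c ^+ 4 = (O3 * c) ^+ 4 * O9); last by ring.
by apply: eqX_mul (eqX_refl _ _); apply/eqX_exp/eqX_sym.
Qed.

End CubicNorm.

Section ChangeOfRings.
Local Open Scope ring_scope.

Lemma eqX_map (R S : comNzRingType) (f : {rmorphism R -> S}) K (p q : {poly R}) :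
  eqX K p q -> eqX K (map_poly f p) (map_poly f q).
Proof.
by move=> [r ->]; exists (map_poly f r); rewrite rmorphD rmorphM /= map_polyXn.
Qed.

Lemma map_psi (R S : comNzRingType) (f : {rmorphism R -> S}) n :
  map_poly f (psi R n) = psi S n.
Proof. by rewrite /psi rmorph_sum; apply: eq_bigr => i _; rewrite /= map_polyXn. Qed.

Lemma map_psi_rest (R S : comNzRingType) (f : {rmorphism R -> S}) n :
  map_poly f (psi_rest R n) = psi_rest S n.
Proof.
rewrite /psi_rest rmorph_sum; apply: eq_bigr => i _.
by rewrite rmorphD /= !map_polyXn.
Qed.

(** No cube root of unity is required of R: both sides come from integer polynomials, which are
    compared inside [algC], where a primitive one exists, and then mapped to R. *)
Lemma psi_norm (R : comNzRingType) n : eqX (3 * n)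
  ((psi R n \Po 'X^9) * ((psi_rest R n \Po 'X^3) ^+ 3 + ('X * (psi R n \Po 'X^9)) ^+ 3))
  ((psi R n \Po 'X^3) ^+ 4).
Proof.
have mapE (S T : comNzRingType) (f : {rmorphism S -> T}) :
    (map_poly f ((psi S n \Po 'X^9) * ((psi_rest S n \Po 'X^3) ^+ 3
       + ('X * (psi S n \Po 'X^9)) ^+ 3)) =
     (psi T n \Po 'X^9) * ((psi_rest T n \Po 'X^3) ^+ 3
       + ('X * (psi T n \Po 'X^9)) ^+ 3)) *
    (map_poly f ((psi S n \Po 'X^3) ^+ 4) = (psi T n \Po 'X^3) ^+ 4).
  split; rewrite !(rmorphD, rmorphM, rmorphXn) /= !map_comp_poly.
    by rewrite !map_polyXn !map_psi !map_psi_rest map_polyX.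
  by rewrite !map_polyXn !map_psi.
suff /(eqX_map (intr : {rmorphism int -> R})) : eqX (3 * n)
    ((psi int n \Po 'X^9) * ((psi_rest int n \Po 'X^3) ^+ 3
      + ('X * (psi int n \Po 'X^9)) ^+ 3))
    ((psi int n \Po 'X^3) ^+ 4) by rewrite !mapE.
apply/eqX_coefP => i ilt; apply: (@intr_inj algC).
rewrite -!(coef_map (intr : {rmorphism int -> algC})) !mapE.
have [w /prim_expr_order w3 w_neq1] : exists2 w : algC, 3.-primitive_root w & w != 1.
  have [w prim_w] := C_prim_root_exists (isT : (0 < 3)%N).
  exists w => //; apply/eqP => w1; have := prim_order_dvd prim_w 1.
  by rewrite w1 expr1n eqxx.
have w_root : 1 + w + w ^+ 2 = 0.
  apply: (mulfI (_ : w - 1 != 0)); first by rewrite subr_eq0.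
  by rewrite mulr0; transitivity (w ^+ 3 - 1); [ring | rewrite w3 subrr].
exact: (eqX_coefP _ _ _).1 (psi_norm_identity w_root n) _ ilt.
Qed.

End ChangeOfRings.

(** * Powers of psi *)

Section PsiPowers.
Local Open Scope ring_scope.

Lemma sum_tri_widen (V : nmodType) k n (F : nat -> V) : (k < n)%N ->
  \sum_(j < n | (tri j <= k)%N) F j = \sum_(j < k.+1 | (tri j <= k)%N) F j.
Proof.
move=> kn; rewrite -!(big_mkord (fun j => tri j <= k)%N F).
rewrite (big_cat_nat (leq0n _) kn) /= [X in _ + X]big_nat_cond [X in _ + X]big_pred0 ?addr0// => j.
by have := tri_double j; nia.
Qed.

Lemma coef_psiM n k (p : {poly int}) : (k < n)%N ->
  (psi int n * p)`_k = \sum_(j < k.+1 | (tri j <= k)%N) p`_(k - tri j).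
Proof.
move=> kn; rewrite -(sum_tri_widen (fun j => p`_(k - tri j)) kn) /psi mulr_suml coef_sum.
rewrite [RHS]big_mkcond; apply: eq_bigr => j _.
by rewrite coefXnM ltnNge if_neg.
Qed.

(* [psi_derivation n p] vanishes to order n iff p is, modulo X^n, a constant
   multiple of [psi ^+ 4]. *)
Definition psi_derivation n (p : {poly int}) : {poly int} :=
  psi int n * ('X * p^`()) - 4 * ('X * (psi int n)^`()) * p.

(** The weight is k - tri j, from differentiating p, minus 4 tri j, from differentiating psi. *)
Lemma coef_psi_derivation n k (p : {poly int}) : (k < n)%N ->
  (psi_derivation n p)`_k =
  \sum_(j < k.+1 | (tri j <= k)%N) (k%:Z - 5 * (tri j)%:Z) * p`_(k - tri j).
Proof.
move=> kn; have Xd (q : {poly int}) i : ('X * q^`())`_i = i%:Z * q`_i.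
  by case: i => [|i]; rewrite coefXM ?mul0r//= coef_deriv -mulr_natl natz.
rewrite -(sum_tri_widen (fun j => (k%:Z - 5 * (tri j)%:Z) * p`_(k - tri j)) kn).
have XpsiE : 'X * (psi int n)^`() = \sum_(j < n) (tri j)%:Z%:P * 'X^(tri j).
  apply/polyP => i; rewrite Xd /psi !coef_sum mulr_sumr; apply: eq_bigr => j _.
  by rewrite coefCM coefXn; case: eqP => [->|]; rewrite ?mulr0.
rewrite /psi_derivation XpsiE /psi mulr_sumr !mulr_suml -sumrB coef_sum.
rewrite [RHS]big_mkcond; apply: eq_bigr => j _.
rewrite -!mulrA coefB -(polyC_natr int 4) !coefCM !coefXnM Xd ltnNge if_neg.
case: ifP => // jk; last by rewrite !mulr0 subr0.
by rewrite -subzn//; ring.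
Qed.

(** In the coefficient formula the term j = 0 is k p_k and the others involve lower coefficients of
    p, so each p_k with k > 0 is determined by induction. *)
Lemma psi_derivation_eq0 n (p : {poly int}) : p`_0 = 0 ->
  (forall k, (k < n)%N -> (psi_derivation n p)`_k = 0) ->
  forall k, (k < n)%N -> p`_k = 0.
Proof.
move=> p0 dp; elim/ltn_ind => k IHk kn.
have [->//|k0] := posnP k.
have := dp k kn; rewrite coef_psi_derivation// (bigD1 ord0)// big1 => [|j /andP[jk j0]].
  rewrite (_ : tri (ord0 : 'I_k.+1) = 0%N)//.
  rewrite /= subn0 => H; have /eqP : k%:Z * p`_k = 0 by rewrite -[RHS]H; ring.
  by rewrite mulf_eq0 => /orP[|/eqP//]; lia.
rewrite IHk ?mulr0//; first by have := tri_double j; move: j0; rewrite -val_eqE /=; nia.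
exact: leq_ltn_trans (leq_subr _ _) kn.
Qed.

Definition sigma_poly n : {poly int} := \poly_(k < n) (sigma (2 * k + 1))%:Z.

Lemma psi_coef0 (R : comNzRingType) n : (psi R n.+1)`_0 = 1.
Proof.
rewrite /psi big_ord_recl coefD coefXn /= coef_sum big1 ?addr0// => i _.
have : (0 < tri (lift ord0 i))%N.
  by have := tri_double (lift ord0 i); rewrite lift0; nia.
by rewrite coefXn; case: (tri _).
Qed.

(** [psi_derivation] kills psi^4 identically and kills [sigma_poly] to order n by
    [sigma_recurrence]; both have constant term 1. *)
Lemma psi_exp4 n : eqX n (psi int n ^+ 4) (sigma_poly n).
Proof.
apply/eqX_coefP => k kn; apply/eqP; rewrite -subr_eq0 -coefB; apply/eqP.
apply: (@psi_derivation_eq0 n) => // [|{k}k {}kn].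
  case: n kn => // n _; rewrite coefB coef_poly /= !exprS expr0 !coef0M psi_coef0 coef1.
  by rewrite /sigma big_seq1.
have -> : psi_derivation n (psi int n ^+ 4 - sigma_poly n) = - psi_derivation n (sigma_poly n).
  by rewrite /psi_derivation derivB deriv_exp /= -mulr_natl; ring.
rewrite coefN coef_psi_derivation//.
have := sigma_recurrence k; move=> H; rewrite -[RHS]oppr0 -[in RHS]H; congr (- _).
apply: eq_bigr => j jk; congr (_ * _); rewrite coef_poly ifT//.
exact: leq_ltn_trans (leq_subr _ _) kn.
Qed.

Lemma psi_exp5_coef m : 2 * (psi int m.+1 ^+ 5)`_m = class_sum (8 * m + 5)%N%:Z.
Proof.
rewrite class_sum_theta exprS; congr (_ * _).
have /eqX_coefP-> // : eqX m.+1 (psi int m.+1 * psi int m.+1 ^+ 4)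
    (psi int m.+1 * sigma_poly m.+1) by apply/eqX_mull/psi_exp4.
rewrite coef_psiM//; apply: eq_bigr => j jm; rewrite coef_poly ifT//.
exact: leq_ltn_trans (leq_subr _ _) (ltnSn m).
Qed.

Lemma psi_cube (R : comNzRingType) n :
  exists g : {poly R}, psi R n ^+ 3 = (psi R n \Po 'X^3) + 3 * g.
Proof.
elim: n => [|n [g gE]]; first by exists 0; rewrite /psi big_ord0 comp_poly0; ring.
have -> : psi R n.+1 = psi R n + 'X^(tri n) by rewrite /psi big_ord_recr.
exists (g + psi R n ^+ 2 * 'X^(tri n) + psi R n * 'X^(tri n) ^+ 2).
rewrite comp_polyD comp_Xn_poly exprAC.
transitivity (psi R n ^+ 3 + 3 * (psi R n ^+ 2 * 'X^(tri n) + psi R n * 'X^(tri n) ^+ 2)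
  + 'X^(tri n) ^+ 3); first by ring.
by rewrite gE; ring.
Qed.

(** Cubing lifts the congruence psi^3 = psi(X^3) modulo 3 to one modulo 9. *)
Lemma psi_exp9 (R : comNzRingType) n : 9%:R = 0 :> R ->
  psi R n ^+ 9 = (psi R n \Po 'X^3) ^+ 3.
Proof.
move=> R9; have [g gE] := psi_cube R n.
have P9 : 9 = 0 :> {poly R} by rewrite -polyC_natr R9.
rewrite (exprM _ 3 3) gE; set u := _ \Po _.
transitivity (u ^+ 3 + 9 * (u ^+ 2 * g + 3 * u * g ^+ 2 + 3 * g ^+ 3)); first by ring.
by rewrite P9 mul0r addr0.
Qed.

Lemma comp_poly_exp (R : comNzRingType) (p q : {poly R}) n :
  p ^+ n \Po q = (p \Po q) ^+ n.
Proof. exact: rmorphXn. Qed.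

(** Put B = psi(X^3), b = psi(X^9), y = X b. Then A^3 + y^3 = B^4 / b gives 1 / psi = (A^2 - A y +
    y^2) b / B^4, whose part with exponents 2 mod 3 is X^2 b^3 / B^4. Modulo 9, b^3 = B^9, which
    leaves X^2 B^5. *)
Lemma pod_psi5 (R : comNzRingType) m : 9%:R = 0 :> R ->
  (-1) ^+ (3 * m + 2) * (pod (3 * m + 2))%:R = (psi R m.+1 ^+ 5)`_m.
Proof.
move=> R9; rewrite -pod_poly_coef; set G := pod_poly _ _.
have K : ((3 * m + 2).+1 = 3 * m.+1)%N by lia.
have := pod_series R (3 * m + 2); rewrite -/G K psi_dissection => Gpsi.
have := psi_norm R m.+1.
have := psi_exp9 m.+1 R9.
move: Gpsi; set a := psi_rest R m.+1; set P := psi R m.+1 => Gpsi P9 norm.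
have b3 : (P \Po 'X^9) ^+ 3 = (P \Po 'X^3) ^+ 9.
  have -> : 'X^9 = 'X^3 \Po 'X^3 :> {poly R} by rewrite comp_Xn_poly -exprM.
  by rewrite comp_polyA -comp_poly_exp P9 comp_poly_exp.
(* After X -> X^3, the fourth power of this truncated inverse stands for B^(-4). *)
have [v Pv] : exists v, eqX m.+1 (P * v) 1 by apply: eqX_inverse; apply: psi_coef0.
have {}Pv : eqX (3 * m.+1) ((P \Po 'X^3) ^+ 4 * (v \Po 'X^3) ^+ 4) 1.
  rewrite -exprMn -comp_polyM -(expr1n _ 4); apply: eqX_exp.
  by have := eqX_comp 3 Pv; rewrite -{2}polyC1 comp_polyC polyC1.
move: norm Gpsi; rewrite [P \Po 'X^9](_ : _ = (P \Po 'X^3) \Po 'X^3); last first.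
  by rewrite -comp_polyA comp_Xn_poly -exprM.
move: b3; rewrite [P \Po 'X^9](_ : _ = (P \Po 'X^3) \Po 'X^3); last first.
  by rewrite -comp_polyA comp_Xn_poly -exprM.
set B := P \Po 'X^3; set b := B \Po 'X^3; set A := a \Po 'X^3; set V := v \Po 'X^3.
move=> b3 norm Gpsi.
pose q := (A ^+ 2 - A * ('X * b) + ('X * b) ^+ 2) * b.
have GB : eqX (3 * m.+1) (G * B ^+ 4) q.
  apply: (eqX_trans (q := G * (b * (A ^+ 3 + ('X * b) ^+ 3)))).
    exact/eqX_mull/eqX_sym.
  rewrite (_ : G * _ = G * (A + 'X * b) * q); last by rewrite /q; ring.
  by rewrite -[X in eqX _ _ X]mul1r; apply: eqX_mul => //; apply: eqX_refl.
have GE : eqX (3 * m.+1) G (q * V ^+ 4).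
  apply: (eqX_trans (q := G * (B ^+ 4 * V ^+ 4))).
    by rewrite -[X in eqX _ X _]mulr1; apply/eqX_mull/eqX_sym.
  by rewrite mulrA; apply: eqX_mul => //; apply: eqX_refl.
have qE : q * V ^+ 4 = A ^+ 2 * b * V ^+ 4 - 'X * (A * b ^+ 2 * V ^+ 4)
    + 'X^2 * (B ^+ 5 * (B ^+ 4 * V ^+ 4)).
  transitivity (A ^+ 2 * b * V ^+ 4 - 'X * (A * b ^+ 2 * V ^+ 4)
    + 'X^2 * (b ^+ 3 * V ^+ 4)); first by rewrite /q; ring.
  by rewrite b3; ring.
have {}GE : eqX (3 * m.+1) G (A ^+ 2 * b * V ^+ 4 - 'X * (A * b ^+ 2 * V ^+ 4)
    + 'X^2 * B ^+ 5).
  apply: (eqX_trans GE); rewrite qE; apply: eqX_add; first exact: eqX_refl.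
  by rewrite -[B ^+ 5 in X in eqX _ _ X]mulr1; do 2![apply: eqX_mull].
have ltm : (3 * m + 2 < 3 * m.+1)%N by lia.
rewrite ((eqX_coefP _ _ _).1 GE _ ltm) coefD coefB.
have -> : A ^+ 2 * b * V ^+ 4 = (a ^+ 2 * B * v ^+ 4) \Po 'X^3.
  by rewrite 2!comp_polyM !comp_poly_exp.
have -> : A * b ^+ 2 * V ^+ 4 = (a * B ^+ 2 * v ^+ 4) \Po 'X^3.
  by rewrite 2!comp_polyM !comp_poly_exp.
have -> : B ^+ 5 = P ^+ 5 \Po 'X^3 by rewrite comp_poly_exp.
rewrite coefXM coefXnM !coef_comp_poly_Xn//.
have -> : (3 %| 3 * m + 2)%N = false by lia.
have -> : (3 %| (3 * m + 2).-1)%N = false by lia.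
have -> : (3 * m + 2 - 2 = 3 * m)%N by lia.
have -> : (3 * m + 2 < 2)%N = false by lia.
have -> : (3 * m + 2 == 0)%N = false by lia.
by rewrite dvdn_mulr// mulKn// subr0 add0r.
Qed.

End PsiPowers.

(** * Congruences for pod *)

Section PodModNine.
Local Open Scope ring_scope.

Lemma natr_Zp9_eq0 n : (n%:R == 0 :> 'Z_9) = (9 %| n)%N.
Proof. by rewrite -val_eqE /= val_Zp_nat. Qed.

Lemma pod_class_sum m :
  2 * ((-1) ^+ (3 * m + 2) * (pod (3 * m + 2))%:R) = (class_sum (8 * m + 5)%N%:Z)%:~R :> 'Z_9.
Proof.
have Z9 : 9%:R = 0 :> 'Z_9 by apply/eqP; rewrite natr_Zp9_eq0.
rewrite pod_psi5// -psi_exp5_coef rmorphM /=.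
rewrite -(map_psi (intr : {rmorphism int -> 'Z_9})) -rmorphXn coef_map.
by [].
Qed.

(** As p^2 = 1 mod 8, p^(2k+1) N is again some 8m + 5, and (3(8m + 5) + 1) / 8 = 3m + 2, so pod is
    read off from S(N p^(2k+1)) modulo 9. *)
Lemma pod_prime_power p N k : prime p -> odd p -> ~~ (p %| N)%N ->
    p * N = 5 %[mod 8] ->
  exists c : 'Z_9, (pod ((3 * p ^ (2 * k + 1) * N + 1) %/ 8))%:R
    = (\sum_(i < k.+1) p%:R ^+ (3 * i)) * c.
Proof.
move=> p_prime p_odd npN pN5.
have [m0 m0E] : exists m0, (p * N = 8 * m0 + 5)%N.
  by exists (p * N %/ 8)%N; rewrite {1}(divn_eq (p * N) 8) pN5; lia.
have [m mE] : exists m, (p ^ (2 * k + 1) * N = 8 * m + 5)%N.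
  elim: k => [|k [m mE]]; first by exists m0.
  have [t tE] : exists t, (p ^ 2 = 8 * t + 1)%N.
    have [h hE] : exists h, p = (2 * h + 1)%N by exists p./2; lia.
    have [u uE] : exists u, (h * h.+1 = 2 * u)%N.
      by exists (tri h); have := tri_double h; lia.
    by exists u; rewrite hE; nia.
  exists (t * (8 * m + 5) + m)%N.
  rewrite (_ : 2 * k.+1 + 1 = 2 + (2 * k + 1))%N; last by lia.
  by rewrite expnD -mulnA mE tE; lia.
have -> : ((3 * p ^ (2 * k + 1) * N + 1) %/ 8 = 3 * m + 2)%N.
  by rewrite -mulnA mE; lia.
have nsq b : b ^+ 2 != N%:Z * p%:Z.
  by rewrite -PoszM mulnC m0E nonsquare_5mod8.
have S_rec : class_sum (8 * m + 5)%N%:Z =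
    (\sum_(i < k.+1) p%:Z ^+ (3 * i)) * class_sum (N%:Z * p%:Z).
  rewrite -(class_sum_prime_power p_prime p_odd k nsq npN); congr class_sum.
  by rewrite -mE mulnC addn1 PoszM; congr (_ * _); rewrite -natz natrX natz.
(* 5 is the inverse of 2 modulo 9, and the sign is its own inverse. *)
exists (5 * (-1) ^+ (3 * m + 2) * (class_sum (N%:Z * p%:Z))%:~R).
have := pod_class_sum m; rewrite S_rec rmorphM /= rmorph_sum /=.
under eq_bigr do rewrite rmorphXn /=.
move=> E; rewrite mulrCA -E; set s := (-1) ^+ _; set x := _%:R.
have s2 : s * s = 1 by rewrite -expr2 sqrr_sign.
transitivity (10 * (s * s) * x); last by ring.
by rewrite s2 mulr1 (_ : 10 = 1) ?mul1r//; apply/val_inj.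
Qed.

End PodModNine.

Theorem theorem2 (p N : nat) (p_prime : prime p) (p_ge3 : 3 <= p)
    (N_gt0 : 0 < N) (pN_mod8 : p * N = 5 %[mod 8])
    (p_ndvd_N : ~~ (p %| N)) (alpha : nat) :
  (p = 1 %[mod 3] ->
     pod ((3 * p ^ (6 * alpha + 5) * N + 1) %/ 8) = 0 %[mod 3] /\
     pod ((3 * p ^ (18 * alpha + 17) * N + 1) %/ 8) = 0 %[mod 9]) /\
  (p = 2 %[mod 3] ->
     pod ((3 * p ^ (4 * alpha + 3) * N + 1) %/ 8) = 0 %[mod 9]).
Proof.
have p_odd : odd p by have [p2|//] := even_prime p_prime; move: p_ge3; rewrite p2.
have pod_k k := pod_prime_power k p_prime p_odd p_ndvd_N pN_mod8.
have cube_mod9 u : (p ^ 3 = u %[mod 9])%N ->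
    forall i, (p%:R ^+ (3 * i) = u%:R ^+ i :> 'Z_9)%R.
  move=> pu i; rewrite GRing.exprM -GRing.natrX; congr (_ ^+ _)%R.
  by apply/val_inj; rewrite /= !val_Zp_nat.
have sum_const (V : nmodType) (x : V) n : (\sum_(i < n) x = x *+ n)%R.
  by rewrite GRing.sumr_const card_ord.
split=> p_mod3.
(* All terms of the geometric sum are then 1, so its value is the number k + 1 of terms. *)
- have p3 : p ^ 3 = 1 %[mod 9].
    have [t ->] : exists t, p = 3 * t + 1 by exists (p %/ 3); lia.
    have -> : (3 * t + 1) ^ 3 = (3 * t ^ 3 + 3 * t ^ 2 + t) * 9 + 1 by lia.
    by rewrite modnMDl.
  have sumE k : (\sum_(i < k.+1) p%:R ^+ (3 * i) = k.+1%:R :> 'Z_9)%R.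
    under eq_bigr do rewrite (cube_mod9 _ p3) GRing.expr1n.
    by rewrite sum_const.
  split.
  + have [c] := pod_k (3 * alpha + 2).
    rewrite sumE (_ : 2 * (3 * alpha + 2) + 1 = 6 * alpha + 5); last by lia.
    set n := pod _ => nE; apply/eqP; rewrite mod0n -/(3 %| n).
    (* Divisibility by 3 is tested in Z/9 after multiplying by 3: there are 3(alpha + 1) terms, and
       three times that is 0 modulo 9. *)
    rewrite -(@dvdn_pmul2l 3)// -natr_Zp9_eq0 GRing.natrM nE GRing.mulrA -GRing.natrM.
    have /eqP-> : ((3 * (3 * alpha + 2).+1)%:R == 0 :> 'Z_9)%R.
      by rewrite natr_Zp9_eq0; lia.
    by rewrite GRing.mul0r.
  + have [c] := pod_k (9 * alpha + 8).
    rewrite sumE (_ : 2 * (9 * alpha + 8) + 1 = 18 * alpha + 17); last by lia.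
    have /eqP-> : ((9 * alpha + 8).+1%:R == 0 :> 'Z_9)%R by rewrite natr_Zp9_eq0; lia.
    by rewrite GRing.mul0r => /eqP; rewrite natr_Zp9_eq0 => /eqP.
(* Now p^3 = -1 modulo 9, so the geometric sum alternates and vanishes when its number of terms is
   even, here 2 alpha + 2. *)
- have p3 : p ^ 3 = 8 %[mod 9].
    have [t ->] : exists t, p = 3 * t + 2 by exists (p %/ 3); lia.
    have -> : (3 * t + 2) ^ 3 = (3 * t ^ 3 + 6 * t ^ 2 + 4 * t) * 9 + 8 by lia.
    by rewrite modnMDl.
  have sumE k : (\sum_(i < (2 * k).+2) p%:R ^+ (3 * i) = 0 :> 'Z_9)%R.
    have N1 : (8%:R = -1 :> 'Z_9)%R by apply/val_inj.
    under eq_bigr do rewrite (cube_mod9 _ p3) N1.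
    elim: k => [|k IHk]; first by apply/val_inj; rewrite !big_ord_recr big_ord0.
    rewrite (_ : (2 * k.+1).+2 = (2 * k).+4); last by lia.
    rewrite 2!big_ord_recr /= IHk GRing.add0r [X in (_ + X)%R]GRing.exprS.
    by rewrite GRing.mulN1r GRing.subrr.
  have [c] := pod_k (2 * alpha).+1.
  rewrite sumE GRing.mul0r (_ : 2 * (2 * alpha).+1 + 1 = 4 * alpha + 3); last by lia.
  by move=> /eqP; rewrite natr_Zp9_eq0 => /eqP.
Qed.
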